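(* Let $f:\mathbb{C}^s\to\mathbb{C}^s$ be an analytic map with $f(0)=0$ and assume that $A=Df(0)$ is semisimple and invertible. Let $\{\lambda_1,\dots,\lambda_s\}$ be the eigenvalues of $A$ and $\{e_1,\dots,e_s\}$ a corresponding basis of eigenvectors; coordinates in $\mathbb{C}^s$ are taken with respect to this basis. Let $X_1$ be an $A$-invariant linear subspace with basis $\{e_1,\dots,e_d\}$, associated (up to renumbering) to eigenvalues $\lambda_1,\dots,\lambda_d$ with $|\lambda_j|<1$ for $1\le j\le d$. Then for any $N\in\mathbb{N}$ there exist an integer $M$, logarithmic variables $\eta=(\eta_1,\dots,\eta_M)$ that are logarithms of power functions, and a logarithmic polynomial $$h^{<N}(x)=\sum_{1\le|n|<N}h_n(\eta(x))\,x^n,\qquad x=(x_1,\dots,x_d)\in X_1,$$ satisfying the support condition, with polynomials $h_n:\mathbb{C}^M\to\mathbb{C}^s$ normalized by $$h_{1@l}=e_l,\qquad 1\le l\le d,$$ and satisfying $\deg h_n\le|n|-1$, such that the invariance equation is solved up to order $N$: $$f(h^{<N}(x))=h^{<N}(Ax)+R_N(x),$$ where the remainder is a logarithmic series $$R_N(x)=\sum_{|n|\ge N}r_n(\eta(x))\,x^n$$ with polynomials $r_n:\mathbb{C}^M\to\mathbb{C}^s$, also satisfying the support condition.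
   Context: $n\in\mathbb{N}^d$ denotes a multi-index ($\mathbb{N}\ni0$), $|n|=\sum_jn_j$, $x^n=x_1^{n_1}\cdots x_d^{n_d}$, $\operatorname{supp}(n)=\{j:n_j\neq0\}$, and $1@l$ is the $l$-th unit multi-index. On $X_1$, $Ax=(\lambda_1x_1,\dots,\lambda_dx_d)$. Logarithmic variables: $\eta_l(x)=\log\mathfrak{p}_l(x)$ with power functions $\mathfrak{p}_l(x)=\sum_{j=1}^dp_{l,j}|x_j|^{\nu_j}$, where $p_{l,j}\ge0$, for each $l$ at least one $p_{l,j}>0$, and the exponents are $\nu_j=\log\gamma/\log|\lambda_j|>0$ for some $0<\gamma<1$, so that $\eta_l(Ax)=\eta_l(x)+\log\gamma$. Support condition (for a logarithmic polynomial or series $\sum_nH_n(\eta)x^n$ with polynomial $H_n$): whenever the variable $\eta_l$ occurs in $H_n$, one has $\{j:p_{l,j}>0\}\subseteq\operatorname{supp}(n)$, i.e. $p_{l,j}>0\Rightarrow n_j>0$. *)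

(* Defs.v *)
From HB Require Import structures.
From mathcomp Require Import all_boot all_order all_algebra.
From mathcomp Require Import finmap complex.
From mathcomp Require Import all_classical all_reals all_analysis.
From mathcomp Require showcase.summability.
(* The notations of mpoly clash with those of mathcomp-analysis. *)
From mathcomp Require Import -(notations) mpoly.

Set Implicit Arguments.
Unset Strict Implicit.
Unset Printing Implicit Defensive.

Import Order.TTheory GRing.Theory Num.Theory numFieldNormedType.Exports.

Local Open Scope ring_scope.
Local Open Scope complex_scope.
Local Open Scope classical_set_scope.

(* Unconditional convergence: the net of the partial sums over all finite
   subsets of I tends to l.  In finite dimension this amounts to absolute
   convergence, so no order on the multi-indices has to be chosen. *)
Definition sums_to (K : numFieldType) (I : choiceType) (s : nat)
    (F : I -> 'rV[K]_s) (l : 'rV[K]_s) : Prop :=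
  summability.partial_sum F @ summability.totally --> l.

Definition modulus (R : realType) (z : R[i]) : R := ComplexField.Normc.normc z.

Definition polydisc (R : realType) (m : nat) (rho : R) (z : 'rV[R[i]]_m) : Prop :=
  forall j, modulus (z 0 j) < rho.

Definition monomial (K : comNzRingType) (m : nat) (x : 'rV[K]_m)
    (n : multinom m) : K :=
  \prod_(j < m) x 0 j ^+ n j.

Definition power_series_term (K : comNzRingType) (s : nat)
    (a : multinom s -> 'rV[K]_s) (z : 'rV[K]_s) (n : multinom s) : 'rV[K]_s :=
  monomial z n *: a n.

Definition analytic_at0 (R : realType) (s : nat)
    (f : 'rV[R[i]]_s -> 'rV[R[i]]_s) : Prop :=
  exists a : multinom s -> 'rV[R[i]]_s, exists2 rho : R, 0 < rho &
    forall z, polydisc rho z -> sums_to (power_series_term a z) (f z).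

Definition entire (R : realType) (s : nat)
    (f : 'rV[R[i]]_s -> 'rV[R[i]]_s) : Prop :=
  exists a : multinom s -> 'rV[R[i]]_s,
    forall z, sums_to (power_series_term a z) (f z).

Section log_series.
Variables (R : realType) (s d M : nat).

Definition exponent (gamma : R) (lam : 'I_d -> R[i]) (j : 'I_d) : R :=
  ln gamma / ln (modulus (lam j)).

(* Row l of p holds the coefficients of the l-th power function. *)
Definition power_coefs (p : 'M[R]_(M, d)) : Prop :=
  (forall l j, 0 <= p l j) /\ (forall l, exists j, 0 < p l j).

Definition power_fun (nu : 'I_d -> R) (p : 'M[R]_(M, d)) (l : 'I_M)
    (x : 'rV[R[i]]_d) : R :=
  \sum_(j < d) p l j * modulus (x 0 j) `^ nu j.

(* ln 0 = 0 in the library.  Where the l-th power function vanishes, so does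
   x_j for every j with p l j > 0; by support_condition the terms in which
   eta_l occurs then contain a factor x_j = 0, so the value given to eta_l is
   irrelevant and these terms are 0, which is also their limit. *)
Definition log_var (nu : 'I_d -> R) (p : 'M[R]_(M, d)) (x : 'rV[R[i]]_d)
    (l : 'I_M) : R[i] :=
  (ln (power_fun nu p l x))%:C.

(* A polynomial map C^M -> C^s is a row of s polynomials in M variables. *)
Definition occurs (l : 'I_M) (H : 'rV[mpoly M R[i]]_s) : Prop :=
  exists i, exists2 m : multinom M, mcoeff m (H 0 i) != 0 & (0 < m l)%N.

Definition support_condition (p : 'M[R]_(M, d))
    (H : multinom d -> 'rV[mpoly M R[i]]_s) (n : multinom d) : Prop :=
  forall l, occurs l (H n) -> forall j, 0 < p l j -> (0 < n j)%N.

Definition log_term (eta : 'rV[R[i]]_d -> 'I_M -> R[i])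
    (H : multinom d -> 'rV[mpoly M R[i]]_s) (x : 'rV[R[i]]_d)
    (n : multinom d) : 'rV[R[i]]_s :=
  monomial x n *: map_mx (meval (eta x)) (H n).

(* bmultinom d N is the finite type of the multi-indices n with |n| < N. *)
Definition log_poly (eta : 'rV[R[i]]_d -> 'I_M -> R[i])
    (h : multinom d -> 'rV[mpoly M R[i]]_s) (N : nat) (x : 'rV[R[i]]_d) :
    'rV[R[i]]_s :=
  \sum_(n : bmultinom d N | (1 <= mdeg n)%N) log_term eta h x n.

Definition log_tail (eta : 'rV[R[i]]_d -> 'I_M -> R[i])
    (r : multinom d -> 'rV[mpoly M R[i]]_s) (N : nat) (x : 'rV[R[i]]_d)
    (n : multinom d) : 'rV[R[i]]_s :=
  if (N <= mdeg n)%N then log_term eta r x n else 0.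

(* The action of A on X_1, in coordinates with respect to the eigenvectors. *)
Definition diag_action (lam : 'I_d -> R[i]) (x : 'rV[R[i]]_d) : 'rV[R[i]]_d :=
  \row_j (lam j * x 0 j).

(* mmeasure mdeg is msize, i.e. total degree + 1 (and 0 for the zero
   polynomial), so this says that every component has degree <= k - 1. *)
Definition deg_le_pred (H : 'rV[mpoly M R[i]]_s) (k : nat) : Prop :=
  forall i, (mmeasure mdeg (H 0%R i) <= k)%N.

End log_series.

(* Main.v *)
Require Import Defs.
From mathcomp Require Import all_boot all_order all_algebra.
From mathcomp Require Import finmap complex.
From mathcomp Require Import all_classical all_reals all_analysis.
From mathcomp Require Import -(notations) mpoly.
From mathcomp Require Import zify lra ring.

Import Order.TTheory GRing.Theory Num.Theory numFieldNormedType.Exports.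
Local Open Scope ring_scope.
Local Open Scope complex_scope.

Set Implicit Arguments.
Unset Strict Implicit.
Unset Printing Implicit Defensive.

(* Each component is taken as one logarithmic variable, eta_l = log |x_l|^nu_l, so that the support
   condition reads: eta_l occurs in h_n only if n_l > 0.  In the basis of eigenvectors, the coefficient
   of x^n in the invariance equation is
     lambda_i u(eta) + g(eta) = lambda^n u(eta + log gamma),
   where g comes from the nonlinear part of f and the h_m with |m| < |n|, and has degree <= |n| - 2.
   Outside resonances the left minus the right operator is a nonzero multiple of the identity plus a
   nilpotent one; at a resonance one has to invert the difference operator u(eta + log gamma) - u(eta),
   which costs one degree and can be done with any variable eta_l, l in supp n.  Hence deg h_n <= |n| - 1.
   The remainder is obtained by rearranging the absolutely convergent double series f(h(x)); it converges
   as soon as the majorants of the components of h lie in the polydisc of convergence of f, and these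
   majorants tend to 0 with x by the support condition. *)

(** * Induction on multi-indices *)

Lemma mnm_ind (n : nat) (Q : multinom n -> Prop) :
  Q (@mnm0 n) -> (forall j m, Q m -> Q (mnm_add (mnm1 j) m)) -> forall m, Q m.
Proof.
move=> Q0 QS m; elim: {m}(mdeg m) {-2}m (erefl (mdeg m)) => [|k IHk] m.
  by move=> /eqP; rewrite mdeg_eq0 => /eqP ->.
move=> mk; have [j mj] : exists j, m j != 0%N.
  apply/existsP; apply: contraTT isT => /existsPn m0.
  have: mdeg m = 0%N by rewrite mdegE big1 // => i _; apply/eqP; rewrite -[_ == _]negbK m0.
  by rewrite mk.
have jm : lem (mnm1 j) m by rewrite lep1mP.
rewrite -(submK jm) addmC; apply: QS; apply: IHk.
by apply: succn_inj; rewrite -mk -[in RHS](submK jm) mdegD mdeg1 addn1.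
Qed.

Lemma mmap1D (n : nat) (S : comNzRingType) (h : 'I_n -> S) (m1 m2 : multinom n) :
  mmap1 h (mnm_add m1 m2) = mmap1 h m1 * mmap1 h m2.
Proof. by apply: commr_mmap1_M => i x; apply: mulrC. Qed.

(** * Polynomials in the logarithmic variables *)

Section LogPolynomials.
Variables (K : numFieldType) (d : nat).
Implicit Types (q : mpoly d K) (n m : multinom d).

(** The degree bound is strict, so that [k = 0] forces [q = 0] and degree at most |n| - 1 reads
    [k = |n|]. The second half is the support condition when each component has its own logarithmic
    variable. *)
Definition log_bounded n (k : nat) q := forall m, mcoeff m q != 0 ->
  (mdeg m < k)%N /\ forall l, (0 < m l)%N -> (0 < n l)%N.

Lemma log_bounded0 n k : log_bounded n k 0.
Proof. by move=> m; rewrite mcoeff0 eqxx. Qed.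

Lemma log_boundedD n k q q' :
  log_bounded n k q -> log_bounded n k q' -> log_bounded n k (q + q').
Proof.
move=> Hq Hq' m; rewrite mcoeffD; have [q0|/Hq//] := eqVneq (mcoeff m q) 0.
by rewrite q0 add0r; apply: Hq'.
Qed.

Lemma log_boundedZ n k c q : log_bounded n k q -> log_bounded n k (c *: q).
Proof. by move=> Hq m; rewrite mcoeffZ mulf_eq0 negb_or => /andP[_ /Hq]. Qed.
#[local] Arguments log_boundedZ {n k} c {q}.

Lemma log_boundedN n k q : log_bounded n k q -> log_bounded n k (- q).
Proof. by move=> Hq m; rewrite mcoeffN oppr_eq0 => /Hq. Qed.

Lemma log_boundedB n k q q' :
  log_bounded n k q -> log_bounded n k q' -> log_bounded n k (q - q').
Proof. by move=> Hq Hq'; apply: log_boundedD => //; apply: log_boundedN. Qed.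

Lemma log_bounded_sum n k (I : Type) (r : seq I) (Q : pred I) (F : I -> mpoly d K) :
  (forall i, Q i -> log_bounded n k (F i)) ->
  log_bounded n k (\sum_(i <- r | Q i) F i).
Proof.
by move=> HF; elim/big_ind: _ => //; [exact: log_bounded0 | exact: log_boundedD].
Qed.

Lemma log_boundedW n k k' q :
  (k <= k')%N -> log_bounded n k q -> log_bounded n k' q.
Proof. by move=> kk' Hq m /Hq[mk ?]; split => //; apply: leq_trans mk kk'. Qed.

Lemma log_bounded_eq0 n q : log_bounded n 0 q -> q = 0.
Proof.
by move=> Hq; apply/mpolyP => m; rewrite mcoeff0; apply/eqP; apply: contraT => /Hq[].
Qed.

Lemma log_bounded_const n c : log_bounded n 1 (mpolyC d c).
Proof.
move=> m; rewrite mcoeffC; have [->|] := eqVneq m (@mnm0 d); last by rewrite mulr0 eqxx.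
by rewrite mdeg0; split => // l; rewrite mnm0E.
Qed.
#[local] Arguments log_bounded_const {n} c.

Lemma log_boundedX n j : (0 < n j)%N -> log_bounded n 2 (mpolyX K (mnm1 j)).
Proof.
move=> nj m; rewrite mcoeffX pnatr_eq0 eqb0 negbK => /eqP <-.
by rewrite mdeg1; split => // l; rewrite mnm1E; case: eqP => // <-.
Qed.

(** Degrees add up, while each strict bound exceeds its degree by one; hence the predecessor. *)
Lemma log_boundedM n1 n2 k1 k2 q1 q2 :
  log_bounded n1 k1 q1 -> log_bounded n2 k2 q2 ->
  log_bounded (mnm_add n1 n2) (k1 + k2).-1 (q1 * q2).
Proof.
move=> H1 H2 m; rewrite -mcoeff_msupp => /msuppM_le /allpairsP[[m1 m2] /=].
rewrite !mcoeff_msupp => -[/H1[d1 s1] /H2[d2 s2] ->]; split.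
  by case: k1 d1 {H1} => // k1 d1; rewrite mdegD addSn /= -addnS leq_add.
by move=> l; rewrite !mnmDE !addn_gt0 => /orP[/s1|/s2] ->; rewrite ?orbT.
Qed.

Lemma log_bounded_supp n n' k q : (forall l, (0 < n l)%N -> (0 < n' l)%N) ->
  log_bounded n k q -> log_bounded n' k q.
Proof. by move=> nn' Hq m /Hq[? s]; split => // l /s/nn'. Qed.

Lemma log_boundedMl n k1 k2 q1 q2 :
  log_bounded n k1 q1 -> log_bounded n k2 q2 ->
  log_bounded n (k1 + k2).-1 (q1 * q2).
Proof.
move=> H1 H2; apply: log_bounded_supp (log_boundedM H1 H2) => l.
by rewrite mnmDE addn_gt0 orbb.
Qed.

(** One constant for all variables, because the action of A adds the same log gamma to every
    eta_l. *)
Definition shift_vars (c : K) q : mpoly d K :=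
  comp_mpoly [tuple mpolyX K (mnm1 i) + mpolyC d c | i < d] q.

Lemma shift_varsD c q q' : shift_vars c (q + q') = shift_vars c q + shift_vars c q'.
Proof. exact: comp_mpolyD. Qed.

Lemma shift_varsB c q q' : shift_vars c (q - q') = shift_vars c q - shift_vars c q'.
Proof. exact: comp_mpolyB. Qed.

Lemma shift_varsZ c k q : shift_vars c (k *: q) = k *: shift_vars c q.
Proof. exact: comp_mpolyZ. Qed.

Lemma shift_varsM c q q' : shift_vars c (q * q') = shift_vars c q * shift_vars c q'.
Proof. exact: rmorphM. Qed.

Lemma shift_varsC c k : shift_vars c (mpolyC d k) = mpolyC d k.
Proof. exact: comp_mpolyC. Qed.

Lemma shift_vars0 c : shift_vars c 0 = 0.
Proof. exact: comp_mpoly0. Qed.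

Lemma shift_varsX c j : shift_vars c (mpolyX K (mnm1 j)) = mpolyX K (mnm1 j) + mpolyC d c.
Proof. by rewrite /shift_vars comp_mpolyXU -tnth_nth tnth_mktuple. Qed.

Lemma shift_vars_sum c (I : Type) (r : seq I) (Q : pred I) (F : I -> mpoly d K) :
  shift_vars c (\sum_(i <- r | Q i) F i) = \sum_(i <- r | Q i) shift_vars c (F i).
Proof. exact: raddf_sum. Qed.

Lemma mpolyX_ind (Q : mpoly d K -> Prop) :
  (forall q q', Q q -> Q q' -> Q (q + q')) -> (forall c q, Q q -> Q (c *: q)) ->
  Q 1 -> (forall j q, Q q -> Q (mpolyX K (mnm1 j) * q)) -> forall q, Q q.
Proof.
move=> QD QZ Q1 QX q; rewrite [q]mpolyE.
have Q0 : Q 0 by rewrite -(scale0r 1); apply: QZ.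
elim/big_ind: _ => // m _; apply: QZ.
by elim/mnm_ind: m => [|j m IHm]; rewrite ?mpolyX0 // mpolyXD; apply: QX.
Qed.

Lemma shift_varsK c : cancel (shift_vars (- c)) (shift_vars c).
Proof.
elim/mpolyX_ind => [q q' Hq Hq'|k q Hq||j q Hq].
- by rewrite !shift_varsD Hq Hq'.
- by rewrite !shift_varsZ Hq.
- by rewrite -(mpolyC1 d K) !shift_varsC.
by rewrite !shift_varsM Hq shift_varsX shift_varsD shift_varsX shift_varsC mpolyCN addrK.
Qed.

Lemma meval_shift_vars c q (v : 'I_d -> K) :
  meval v (shift_vars c q) = meval (fun l => v l + c) q.
Proof.
elim/mpolyX_ind: q => [q q' Hq Hq'|k q Hq||j q Hq].
- by rewrite shift_varsD !mevalD Hq Hq'.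
- by rewrite shift_varsZ !mevalZ Hq.
- by rewrite -(mpolyC1 d K) shift_varsC !mevalC.
by rewrite shift_varsM !mevalM Hq shift_varsX mevalD mevalC !mevalXU.
Qed.

(** The difference of X_j X^m is X_j times the difference of X^m plus c times the shifted X^m. The
    bound [mdeg m] being strict, the difference operator lowers the degree. *)
Lemma log_bounded_shift_mnm n c m :
  (forall l, (0 < m l)%N -> (0 < n l)%N) ->
  log_bounded n (mdeg m) (shift_vars c (mpolyX K m) - mpolyX K m).
Proof.
elim/mnm_ind: m => [_|j m IHm mn].
  by rewrite mpolyX0 -(mpolyC1 d K) shift_varsC subrr; apply: log_bounded0.
have nj : (0 < n j)%N by apply: mn; rewrite mnmDE mnm1E eqxx.
have mn' l : (0 < m l)%N -> (0 < n l)%N.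
  by move=> ml; apply: mn; rewrite mnmDE addn_gt0 ml orbT.
have {}IHm := IHm mn'.
rewrite mpolyXD shift_varsM shift_varsX mdegD mdeg1 add1n mulrDl addrAC -mulrBr mul_mpolyC.
apply: log_boundedD; first by have := log_boundedMl (log_boundedX nj) IHm.
apply: log_boundedZ; rewrite -(subrK (mpolyX K m) (shift_vars _ _)).
apply: log_boundedD; first by apply: log_boundedW IHm.
by move=> k; rewrite mcoeffX pnatr_eq0 eqb0 negbK => /eqP <-.
Qed.
#[local] Arguments log_bounded_shift_mnm {n} c {m}.

Lemma log_bounded_shiftB n k c q :
  log_bounded n k q -> log_bounded n k.-1 (shift_vars c q - q).
Proof.
move=> Hq; rewrite [q]mpolyE shift_vars_sum -sumrB big_seq.
apply: log_bounded_sum => m; rewrite mcoeff_msupp => /Hq[mk mn].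
rewrite shift_varsZ -scalerBr; apply: log_boundedZ.
by apply: log_boundedW (log_bounded_shift_mnm c mn); rewrite -ltnS (ltn_predK mk).
Qed.
#[local] Arguments log_bounded_shiftB {n k} c {q}.

Lemma log_bounded_shift n k c q : log_bounded n k q -> log_bounded n k (shift_vars c q).
Proof.
move=> Hq; rewrite -(subrK q (shift_vars c q)); apply: log_boundedD => //.
exact: log_boundedW (leq_pred k) (log_bounded_shiftB c Hq).
Qed.
#[local] Arguments log_bounded_shift {n k} c {q}.

(* The binomial coefficient (X_j / c choose a). *)
Fixpoint newton (c : K) (j : 'I_d) (a : nat) : mpoly d K :=
  if a is a'.+1 then
    a'.+1%:R^-1 *: (newton c j a' * (c^-1 *: mpolyX K (mnm1 j) - mpolyC d a'%:R))
  else 1.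

(** Pascal's rule for binomial coefficients in t = X_j / c, since the shift by c turns t into t +
    1. *)
Lemma shift_newton c j a : c != 0 ->
  shift_vars c (newton c j a.+1) = newton c j a.+1 + newton c j a.
Proof.
move=> c0; elim: a => [|a IHa].
  rewrite /= !mul1r !invr1 !scale1r shift_varsB shift_varsZ shift_varsX shift_varsC.
  by rewrite scalerDr -mul_mpolyC -[c^-1 *: _ as X in _ + X]mul_mpolyC -mpolyCM mulVf// mpolyC1 addrAC.
rewrite [newton _ _ a.+2]/= -/(newton c j a.+1) shift_varsZ shift_varsM IHa.
rewrite shift_varsB shift_varsZ shift_varsX shift_varsC.
set B1 := newton c j a.+1; set B0 := newton c j a.
(* [Y] is t - a. The last factor of the next binomial coefficient is [Y - 1], and the shift turns it
   into [Y]. *)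
set Y := c^-1 *: mpolyX K (mnm1 j) - mpolyC d a%:R.
have B0Y : B0 * Y = a.+1%:R *: B1 by rewrite /B1 /= scalerA mulfV ?pnatr_eq0 // scale1r.
have -> : c^-1 *: mpolyX K (mnm1 j) - mpolyC d a.+1%:R = Y - 1.
  by rewrite /Y -addn1 natrD mpolyCD mpolyC1 opprD addrA.
have -> : c^-1 *: (mpolyX K (mnm1 j) + mpolyC d c) - mpolyC d a.+1%:R = Y.
  rewrite /Y -addn1 natrD mpolyCD mpolyC1 scalerDr -[c^-1 *: mpolyC d c]mul_mpolyC.
  by rewrite -mpolyCM mulVf // mpolyC1 opprD addrACA subrr addr0.
move: B1 B0 Y B0Y => B1 B0 Y B0Y.
apply: (scalerI (_ : a.+2%:R != 0)); first by rewrite pnatr_eq0.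
rewrite scalerDr !scalerA mulfV ?pnatr_eq0 // !scale1r mulrDl B0Y mulrBr mulr1.
by rewrite -addrA; congr (_ + _); rewrite -[a.+2]addn1 natrD scalerDl scale1r addrC addrK.
Qed.

Lemma log_bounded_newton n c j a : (0 < n j)%N -> log_bounded n a.+1 (newton c j a).
Proof.
move=> nj; elim: a => [|a IHa].
  by rewrite /= -(mpolyC1 d K); apply: log_bounded_const.
apply: log_boundedZ; rewrite -[a.+2](_ : (a.+1 + 2).-1 = _); last by rewrite addn2.
apply: log_boundedMl => //; apply: log_boundedB.
  by apply: log_boundedZ; apply: log_boundedX.
by apply: (@log_boundedW _ 1) => //; apply: log_bounded_const.
Qed.
#[local] Arguments log_bounded_newton {n} c {j} a.

(* Discrete integration by parts against the Newton basis; each step lowers the degree of [q]. *)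
Lemma shift_antidifference_newton n k c j a q : c != 0 -> (0 < n j)%N ->
  log_bounded n k q ->
  exists2 u, log_bounded n (k + a).+1 u & shift_vars c u - u = newton c j a * q.
Proof.
move=> c0 nj; elim: k a q => [|k IHk] a q Hq.
  exists 0; first exact: log_bounded0.
  by rewrite (log_bounded_eq0 Hq) shift_vars0 mulr0 subrr.
have [u Hu uE] := IHk a.+1 _ (log_bounded_shiftB (- c) Hq).
(* Because the second factor is shifted back, the difference of the product is [newton c j a * q]
   plus [newton c j a.+1] times [q - shift_vars (- c) q]; the second term is cancelled by [u]. *)
exists (newton c j a.+1 * shift_vars (- c) q + u).
  apply: log_boundedD; last by rewrite addSnnS.
  have := log_boundedMl (log_bounded_newton c a.+1 nj) (log_bounded_shift (- c) Hq).
  by apply: log_boundedW; rewrite !addSn addnC.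
rewrite shift_varsD shift_varsM shift_varsK shift_newton // opprD addrACA uE.
by rewrite mulrBr mulrDl addrA subrK addrAC subrr add0r.
Qed.

(** At a resonance [mu = lam] this is a pure difference equation, which costs one degree and takes a
    variable X_j with n_j > 0 from [n != 0]. Otherwise the operator is [mu - lam] plus [mu] times
    the degree-lowering difference, and no degree is lost. *)
Lemma shift_equation n k c lam mu q : c != 0 -> n != @mnm0 d -> mu != 0 ->
  log_bounded n k q ->
  exists2 u, log_bounded n k.+1 u & lam *: u + q = mu *: shift_vars c u.
Proof.
move=> c0 n0 mu0; have [<-|lam_mu] := eqVneq mu lam.
  have [j nj] : exists j, (0 < n j)%N.
    apply/existsP; apply: contraNT n0 => /existsPn n0; apply/eqP/mnmP => i.
    by rewrite mnm0E; apply/eqP; rewrite -leqn0 leqNgt n0.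
  move=> Hq; have [u Hu uE] := shift_antidifference_newton 0 c0 nj (log_boundedZ mu^-1 Hq).
  exists u; first by rewrite addn0 in Hu.
  rewrite -(subrK u (shift_vars c u)) uE mul1r scalerDr scalerA mulfV // scale1r.
  exact: addrC.
suff solve k' q' : log_bounded n k' q' ->
    exists2 u, log_bounded n k' u & lam *: u + q' = mu *: shift_vars c u.
  by move=> /solve[u Hu uE]; exists u => //; apply: log_boundedW Hu.
elim: k' q' => [|k' IHk] q' Hq.
  exists 0; first exact: log_bounded0.
  by rewrite (log_bounded_eq0 Hq) shift_vars0 !scaler0 addr0.
(* [u0] ignores the difference term. The error is [- mu] times the difference of [u0], which has
   smaller degree and is left to the induction hypothesis. *)
pose u0 := (mu - lam)^-1 *: q'.
have Hu0 : log_bounded n k'.+1 u0 by apply: log_boundedZ.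
have [u1 Hu1 u1E] := IHk _ (log_boundedZ (- mu) (log_bounded_shiftB c Hu0)).
exists (u0 + u1); first by apply: log_boundedD => //; apply: log_boundedW Hu1.
rewrite shift_varsD !scalerDr -u1E scaleNr scalerBr.
have -> : q' = (mu - lam) *: u0 by rewrite scalerA mulfV ?scale1r // subr_eq0.
rewrite scalerBl opprB; set X := mu *: shift_vars c u0.
by rewrite [X in _ = _ + X]addrA subrKC [lam *: u0 + _]addrC -addrA subrKC.
Qed.

End LogPolynomials.

(** * The formal invariance equation *)

Section FormalSubstitution.

(** Order of vanishing at least k at the origin. The coefficients are logarithmic polynomials in the
    formal part and numbers once the logarithms are evaluated. *)
Definition coef_from (S : nzRingType) (d k : nat) (P : mpoly d S) :=
  forall n, (mdeg n < k)%N -> mcoeff n P = 0.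

Lemma coef_fromM (S : comNzRingType) (d k l : nat) (P Q : mpoly d S) :
  coef_from k P -> coef_from l Q -> coef_from (k + l) (P * Q).
Proof.
move=> HP HQ n nkl; rewrite mcoeffM big1 // => -[n1 n2] /= /eqP nE.
have [/HP->|kn1] := ltnP (mdeg n1) k; first by rewrite mul0r.
rewrite (HQ n2) ?mulr0 // ltnNge; apply: contraTN nkl => ln2.
by rewrite nE mdegD -leqNgt leq_add.
Qed.

Lemma coef_from_mmap1 (S : comNzRingType) (d s : nat) (P : 'I_s -> mpoly d S) m :
  (forall i, coef_from 1 (P i)) -> coef_from (mdeg m) (mmap1 P m).
Proof.
move=> HP; elim/mnm_ind: m => [|j m IHm]; first by move=> n; rewrite mdeg0.
by rewrite mmap1D mmap1U mdegD mdeg1; apply: coef_fromM.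
Qed.

(* For |m| >= 2 the gain |m| - 1 makes the order-by-order recursion possible: the nonlinear part at
   order k only involves the terms of order < k. *)
Lemma coef_from_mmap1B (S : comNzRingType) (d s k : nat)
    (P P' : 'I_s -> mpoly d S) m :
  (forall i, coef_from 1 (P i)) -> (forall i, coef_from 1 (P' i)) ->
  (forall i, coef_from k (P' i - P i)) ->
  coef_from (k + mdeg m).-1 (mmap1 P' m - mmap1 P m).
Proof.
move=> HP HP' HB; elim/mnm_ind: m => [|j m IHm].
  by move=> n _; rewrite !mmap11 subrr mcoeff0.
rewrite !mmap1D !mmap1U mdegD mdeg1 addnA addn1 addSn /= => n nk.
rewrite -(subrKA (P j * mmap1 P' m)) -mulrBl -mulrBr mcoeffD.
rewrite (coef_fromM (HB j) (coef_from_mmap1 HP')) // add0r.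
by rewrite (coef_fromM (HP j) IHm) // (leq_trans nk) // add1n leqSpred.
Qed.

Variables (K : numFieldType) (d s : nat).

(** The outer variables are the x_j, the inner ones the eta_l. The logarithmic degree in front of
    x^n is at most |n| - k, and the coefficient vanishes for |n| < k. The defects k add up in
    products, so a product of m components of h has degree at most |n| - m. *)
Definition log_graded k (P : mpoly d (mpoly d K)) :=
  forall n, log_bounded n ((mdeg n).+1 - k) (mcoeff n P).

Lemma log_graded_coef_from k P : log_graded k P -> coef_from k P.
Proof.
move=> HP n nk; apply: (@log_bounded_eq0 _ _ n).
by apply: log_boundedW (HP n); rewrite leqn0 subn_eq0.
Qed.

Lemma log_graded1 : log_graded 0 1.
Proof.
move=> n; rewrite subn0 mcoeff1; case: eqP => [->|_]; last exact: log_bounded0.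
by rewrite mdeg0 /= -(mpolyC1 d K); apply: log_bounded_const.
Qed.

Lemma log_gradedM k l P Q :
  log_graded k P -> log_graded l Q -> log_graded (k + l) (P * Q).
Proof.
move=> HP HQ n; rewrite mcoeffM.
suff H (n1 n2 : multinom d) : log_bounded (mnm_add n1 n2)
    ((mdeg (mnm_add n1 n2)).+1 - (k + l)) (mcoeff n1 P * mcoeff n2 Q).
  by apply: log_bounded_sum => -[n1 n2] /= /eqP nE; have := H n1 n2; rewrite -nE.
(* The truncated differences add up correctly only for |n1| >= k and |n2| >= l; in the other cases a
   factor is 0. *)
have [n1k|kn1] := ltnP (mdeg n1) k.
  by rewrite (log_graded_coef_from HP) // mul0r; apply: log_bounded0.
have [n2l|ln2] := ltnP (mdeg n2) l.
  by rewrite (log_graded_coef_from HQ) // mulr0; apply: log_bounded0.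
apply: log_boundedW (log_boundedM (HP n1) (HQ n2)); rewrite mdegD; lia.
Qed.

Lemma log_graded_mmap1 (P : 'I_s -> mpoly d (mpoly d K)) m :
  (forall i, log_graded 1 (P i)) -> log_graded (mdeg m) (mmap1 P m).
Proof.
move=> HP; elim/mnm_ind: m => [|j m IHm]; first by rewrite mmap11 mdeg0; apply: log_graded1.
by rewrite mmap1D mmap1U mdegD mdeg1; apply: log_gradedM.
Qed.

Variable a : multinom s -> 'rV[K]_s.
Implicit Types (h : multinom d -> 'rV[mpoly d K]_s) (n : multinom d).

Definition formal_log_poly h N i : mpoly d (mpoly d K) :=
  \sum_(n : bmultinom d N) h n 0 i *: mpolyX (mpoly d K) n.

(* Monomials of degree > |n| in the substituted series do not contribute to the coefficient
   of x^n, so that the bound on m is immaterial. *)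
Definition comp_coef h N n : 'rV[mpoly d K]_s :=
  \row_i \sum_(m : bmultinom s (mdeg n).+2)
    a m 0 i *: mcoeff n (mmap1 (formal_log_poly h N) m).

Definition comp_coef_nonlinear h N n i : mpoly d K :=
  \sum_(m : bmultinom s (mdeg n).+2 | (2 <= mdeg m)%N)
    a m 0 i *: mcoeff n (mmap1 (formal_log_poly h N) m).

(** At [n = 0] this forces [h 0 = 0], so that substituting h into a power series makes sense
    formally. *)
Definition log_normed h := forall n i, log_bounded n (mdeg n) (h n 0 i).

Lemma mcoeff_formal_log_poly h N n i :
  mcoeff n (formal_log_poly h N i) = if (mdeg n < N)%N then h n 0 i else 0.
Proof.
case: ltnP => nN; first exact: (mcoeff_mpoly (fun n => h n 0 i) nN).
rewrite raddf_sum /= big1 // => m _; rewrite mcoeffZ mcoeffX.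
case: eqP => [mn|_]; last by rewrite mulr0.
by have := bmdeg m; rewrite mn ltnNge nN.
Qed.

Lemma log_graded_formal_log_poly h N i : log_normed h -> log_graded 1 (formal_log_poly h N i).
Proof.
move=> Hh n; rewrite mcoeff_formal_log_poly subSS subn0.
by case: ifP => _; [apply: Hh | apply: log_bounded0].
Qed.

Lemma log_graded_mmap1_formal h N m : log_normed h ->
  log_graded (mdeg m) (mmap1 (formal_log_poly h N) m).
Proof.
by move=> Hh; apply: log_graded_mmap1 => i; apply: log_graded_formal_log_poly.
Qed.

Lemma sum_bmultinom_split (V : nmodType) B (F : multinom s -> V) : F (@mnm0 s) = 0 ->
  \sum_(m : bmultinom s B.+2) F m =
  \sum_(j < s) F (mnm1 j) + \sum_(m : bmultinom s B.+2 | (2 <= mdeg m)%N) F m.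
Proof.
move=> F0; rewrite (bigID (fun m : bmultinom s B.+2 => (2 <= mdeg m)%N)) /= addrC.
congr (_ + _); rewrite (bigID (fun m : bmultinom s B.+2 => mdeg m == 1%N)) /=.
rewrite [X in _ + X]big1 ?addr0 => [|m /andP[m2 m1]]; last first.
  by move: m2 m1; case: (posnP (mdeg m)) => [/eqP|]; [rewrite mdeg_eq0 => /eqP -> |
    case: (mdeg m) => [|[]]].
have b1 (j : 'I_s) : (mdeg (mnm1 j) < B.+2)%N by rewrite mdeg1.
pose pick_var (m : bmultinom s B.+2) : option 'I_s := [pick j | bmnm m == mnm1 j].
rewrite (reindex_omap (fun j => BMultinom (b1 j)) pick_var) /=.
  apply: eq_bigl => j; rewrite mdeg1 /= /pick_var; case: pickP => [k /=|/(_ j)]; last by rewrite eqxx.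
  by rewrite eq_mnm1 => /eqP ->; rewrite eqxx.
move=> m /andP[_ /mdeg1P[j mj]]; rewrite /pick_var; case: pickP => [k /eqP mk|/(_ j)].
  by congr Some; apply/eqP; rewrite bmeqP /= mk.
by rewrite mj.
Qed.

Lemma comp_coef_split h N n i : a (@mnm0 s) = 0 -> (mdeg n < N)%N ->
  comp_coef h N n 0 i =
  \sum_(j < s) a (mnm1 j) 0 i *: h n 0 j + comp_coef_nonlinear h N n i.
Proof.
move=> a0 nN; rewrite mxE (sum_bmultinom_split _
  (F := fun m => a m 0 i *: mcoeff n (mmap1 (formal_log_poly h N) m))).
  congr (_ + _); apply: eq_bigr => j _.
  by rewrite mmap1U mcoeff_formal_log_poly nN.
by rewrite a0 mxE scale0r.
Qed.

Lemma log_bounded_comp_coef h N n i : log_normed h ->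
  log_bounded n (mdeg n).+1 (comp_coef h N n 0 i).
Proof.
move=> Hh; rewrite mxE; apply: log_bounded_sum => m _; apply: log_boundedZ.
by apply: log_boundedW (@log_graded_mmap1_formal h N m Hh n); apply: leq_subr.
Qed.

(** Products of at least two components have logarithmic degree at most |n| - 2, which leaves room
    for the degree lost at a resonance. *)
Lemma log_bounded_comp_coef_nonlinear h N n i : log_normed h ->
  log_bounded n (mdeg n).-1 (comp_coef_nonlinear h N n i).
Proof.
move=> Hh; apply: log_bounded_sum => m m2; apply: log_boundedZ.
apply: log_boundedW (@log_graded_mmap1_formal h N m Hh n).
lia.
Qed.

(** * Stability of the coefficients when one more order is added *)

Section Truncation.
Variables (h h' : multinom d -> 'rV[mpoly d K]_s) (N : nat).
Hypotheses (Hh : log_normed h) (Hh' : log_normed h').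
Hypothesis hh' : forall n, (mdeg n < N)%N -> h' n = h n.

(** The two formal polynomials differ only by terms of degree N, so [coef_from_mmap1B] applies with
    k = N. *)
Lemma mcoeff_mmap1_trunc n m : (mdeg n < (N + mdeg m).-1)%N ->
  mcoeff n (mmap1 (formal_log_poly h' N.+1) m) = mcoeff n (mmap1 (formal_log_poly h N) m).
Proof.
move=> nN; apply/eqP; rewrite -subr_eq0 -mcoeffB; apply/eqP.
apply: (coef_from_mmap1B _ _ _ nN) => i.
- by apply: log_graded_coef_from; apply: log_graded_formal_log_poly.
- by apply: log_graded_coef_from; apply: log_graded_formal_log_poly.
move=> k kN; rewrite mcoeffB !mcoeff_formal_log_poly kN ltnS ltnW // hh' //.
exact: subrr.
Qed.

Lemma comp_coef_trunc n : (mdeg n < N)%N -> comp_coef h' N.+1 n = comp_coef h N n.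
Proof.
move=> nN; apply/rowP => i.
rewrite [LHS]mxE [RHS]mxE; apply: eq_bigr => m _.
apply: (congr1 (fun q => _ *: q)).
have [/eqP|m0] := posnP (mdeg m); last first.
  apply: mcoeff_mmap1_trunc; rewrite (leq_trans nN) //.
  by rewrite -ltnS prednK ?addn_gt0 ?m0 ?orbT // -addn1 leq_add2l.
by rewrite mdeg_eq0 => /eqP ->; rewrite !mmap11.
Qed.

(** Since |m| >= 2, degree N itself is included: the new terms of degree N enter the equation of
    order N only through the linear part. *)
Lemma comp_coef_nonlinear_trunc n i : (mdeg n <= N)%N ->
  comp_coef_nonlinear h' N.+1 n i = comp_coef_nonlinear h N n i.
Proof.
move=> nN; apply: eq_bigr => m m2; apply: (congr1 (fun q => _ *: q)).
apply: mcoeff_mmap1_trunc.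
by rewrite (leq_ltn_trans nN) // -ltnS prednK ?addn_gt0 ?(ltnW m2) ?orbT // -addn2 leq_add2l.
Qed.
End Truncation.

(** * Solution of the homological equations, order by order *)

Section Recursion.
Variables (e : 'M[K]_s) (lam : 'I_s -> K) (iota : 'I_d -> 'I_s) (c : K).
Hypotheses (a0 : a (@mnm0 s) = 0) (e_unit : e \in unitmx).
Hypothesis e_eigen : forall j i, \sum_k e j k * a (mnm1 k) 0 i = lam j * e j i.
Hypotheses (lam_neq0 : forall j, lam j != 0) (c_neq0 : c != 0).

Let lam_mon n := mmap1 (lam \o iota) n.

(** In the eigenbasis the system splits into one [shift_equation] per eigenvalue. For |n| = 1 the
    source term is 0 and the constant eigenvector e_l is a solution, which gives the normalization;
    for n = 0 the solution is 0. *)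
Lemma homological_equation n (g : 'I_s -> mpoly d K) :
  (forall i, log_bounded n (mdeg n).-1 (g i)) ->
  exists q : 'rV[mpoly d K]_s,
    [/\ forall i, log_bounded n (mdeg n) (q 0 i),
        forall i, \sum_k a (mnm1 k) 0 i *: q 0 k + g i = lam_mon n *: shift_vars c (q 0 i)
      & forall l, n = mnm1 l -> q = map_mx (mpolyC d (R := K)) (row (iota l) e)].
Proof.
move=> Hg; have g0 : (mdeg n <= 1)%N -> forall i, g i = 0.
  by move=> n1 i; apply: (@log_bounded_eq0 _ _ n); apply: log_boundedW (Hg i); case: (mdeg n) n1 => [|[]].
have [/eqP/mdeg1P[l /eqP nl]|n1] := eqVneq (mdeg n) 1%N.
  exists (map_mx (mpolyC d (R := K)) (row (iota l) e)); split => [i|i|l' nl'].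
  - by rewrite nl mdeg1 !mxE; apply: log_bounded_const.
  - rewrite g0 ?nl ?mdeg1 // addr0 /lam_mon mmap1U !mxE shift_varsC -mul_mpolyC -mpolyCM.
    rewrite -e_eigen raddf_sum; apply: eq_bigr => k _.
    by rewrite !mxE -mul_mpolyC -mpolyCM mulrC.
  - by congr (map_mx _ (row (iota _) _)); apply/eqP; rewrite -(eq_mnm1 l l') -nl -nl'.
have [/eqP|n_gt0] := posnP (mdeg n).
  rewrite mdeg_eq0 => /eqP n0; exists 0; split => [i|i|l nl].
  - by rewrite mxE; apply: log_bounded0.
  - rewrite g0 ?n0 ?mdeg0 // mxE shift_vars0 scaler0 addr0.
    by rewrite big1 // => k _; rewrite mxE scaler0.
  - by have := mdeg1 l; rewrite -nl n0 mdeg0.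
(* Coordinates of the row g in the eigenbasis, whose vectors are the rows of [e]. *)
pose g' j := \sum_k invmx e k j *: g k.
have Hg' j : log_bounded n (mdeg n).-1 (g' j).
  by apply: log_bounded_sum => k _; apply: log_boundedZ.
have n0 : n != @mnm0 d by rewrite -mdeg_eq0 -lt0n.
have lam0 : lam_mon n != 0 by apply/prodf_neq0 => j _; rewrite expf_neq0 //=.
have [u Hu uE] : exists2 u : 'I_s -> mpoly d K, forall j, log_bounded n (mdeg n) (u j) &
    forall j, lam j *: u j + g' j = lam_mon n *: shift_vars c (u j).
  have /choice[u Hu] : forall j, exists u, log_bounded n (mdeg n) u /\
      lam j *: u + g' j = lam_mon n *: shift_vars c u.
    move=> j; have [u] := shift_equation (lam j) c_neq0 n0 lam0 (Hg' j).
    by rewrite prednK // => Hu uE; exists u.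
  by exists u => j; have [] := Hu j.
exists (\row_i \sum_j e j i *: u j); split => [i|i|l nl]; last by rewrite nl mdeg1 eqxx in n1.
  by rewrite mxE; apply: log_bounded_sum => j _; apply: log_boundedZ.
have gE : g i = \sum_j e j i *: g' j.
  under eq_bigr do rewrite scaler_sumr.
  (* [g i] becomes a sum over k against the Kronecker delta, to be matched with the entries of
     [invmx e *m e]. *)
  rewrite exchange_big /= -[LHS]scale1r -(big_pred1_eq +%R i (fun k => 1 *: g k)).
  rewrite big_mkcond /=; apply: eq_bigr => k _.
  have := congr1 (fun M : 'M[K]_s => M k i) (mulVmx e_unit); rewrite !mxE => eE.
  under eq_bigr => j _ do rewrite scalerA mulrC.
  by rewrite -scaler_suml eE; case: eqP => _; rewrite ?scale1r ?scale0r.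
rewrite mxE shift_vars_sum scaler_sumr gE.
under eq_bigr => k _ do rewrite mxE scaler_sumr.
rewrite exchange_big -big_split /=; apply: eq_bigr => j _.
under eq_bigr => k _ do rewrite scalerA mulrC.
rewrite -scaler_suml e_eigen mulrC -scalerA -scalerDr uE shift_varsZ !scalerA mulrC //.
Qed.

(** Induction on N: only the coefficients of degree N are replaced. The lower equations survive by
    [comp_coef_trunc], and the one of order N is a homological equation whose source term is already
    known. *)
Lemma formal_invariance N : exists h,
  [/\ log_normed h,
      forall l, h (mnm1 l) = map_mx (mpolyC d (R := K)) (row (iota l) e) &
      forall n i, (mdeg n < N)%N ->
        comp_coef h N n 0 i = lam_mon n *: shift_vars c (h n 0 i)].
Proof.
elim: N => [|N [h [Hh hl hE]]].
  (* No equation is required yet; this start provides the normalization and the degree bounds for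
     every n. *)
  have /choice[h Hh] n := @homological_equation n (fun=> 0) (fun=> @log_bounded0 _ _ _ _).
  exists h; split => [n i|l|//]; first by have [] := Hh n.
  by have [_ _] := Hh (mnm1 l); apply.
have Hg n i : log_bounded n (mdeg n).-1 (comp_coef_nonlinear h N n i).
  exact: log_bounded_comp_coef_nonlinear.
have /choice[q Hq] n := homological_equation (Hg n).
pose h' n := if mdeg n == N then q n else h n.
have Hh' : log_normed h'.
  by move=> n i; rewrite /h'; case: eqP => _; [have [] := Hq n | apply: Hh].
have hh' n : (mdeg n < N)%N -> h' n = h n by move=> nN; rewrite /h' ltn_eqF.
exists h'; split => // [l|n i].
  by rewrite /h'; case: eqP => _ //; have [_ _] := Hq (mnm1 l); apply.
rewrite ltnS leq_eqVlt => /orP[/eqP nN|nN]; last by rewrite (comp_coef_trunc Hh Hh' hh') // hE // hh'.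
rewrite comp_coef_split ?nN // (comp_coef_nonlinear_trunc Hh Hh' hh') ?nN //.
by have [_ qE _] := Hq n; rewrite /h' nN eqxx qE.
Qed.
End Recursion.
End FormalSubstitution.

(** * Unconditional sums of complex numbers *)

Section Modulus.
Variable R : realType.
Implicit Types z w : R[i].

Lemma normr_modulus z : `|z| = (modulus z)%:C. Proof. by []. Qed.
Lemma modulus_ge0 z : 0 <= modulus z. Proof. by rewrite -lecR -normr_modulus normr_ge0. Qed.
Lemma modulus0 : modulus (0 : R[i]) = 0. Proof. exact: ComplexField.Normc.normc0. Qed.
Lemma modulus1 : modulus (1 : R[i]) = 1. Proof. exact: ComplexField.Normc.normc1. Qed.
Lemma modulusM : {morph @modulus R : z w / z * w}. Proof. exact: ComplexField.Normc.normcM. Qed.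
Lemma modulusX z n : modulus (z ^+ n) = modulus z ^+ n.
Proof. by elim: n => [|n IHn]; rewrite ?modulus1 // !exprS modulusM IHn. Qed.
Lemma modulusN z : modulus (- z) = modulus z.
Proof. by apply: (@complexI R); rewrite -!normr_modulus normrN. Qed.
Lemma modulus_eq0 z : (modulus z == 0) = (z == 0).
Proof. by apply/eqP/eqP => [/ComplexField.Normc.eq0_normc|->] //; apply: modulus0. Qed.
Lemma ler_modulusD z w : modulus (z + w) <= modulus z + modulus w.
Proof. by rewrite -lecR rmorphD -!normr_modulus ler_normD. Qed.
Lemma ler_modulusB z w : modulus (z - w) <= modulus z + modulus w.
Proof. by rewrite -(modulusN w) ler_modulusD. Qed.
Lemma modulus_real (x : R) : modulus x%:C = `|x|.
Proof. by rewrite /modulus /= expr0n addr0 sqrtr_sqr. Qed.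
Lemma ler_modulus_sum (I : Type) (r : seq I) (Q : pred I) (F : I -> R[i]) :
  modulus (\sum_(i <- r | Q i) F i) <= \sum_(i <- r | Q i) modulus (F i).
Proof.
elim/big_rec2: _ => [|i y z _ zy]; first by rewrite modulus0.
by apply: le_trans (ler_modulusD _ _) _; rewrite lerD2l.
Qed.
Lemma modulus_prod (I : Type) (r : seq I) (Q : pred I) (F : I -> R[i]) :
  modulus (\prod_(i <- r | Q i) F i) = \prod_(i <- r | Q i) modulus (F i).
Proof. by apply: (big_morph (@modulus R)); [apply: modulusM | apply: modulus1]. Qed.
Lemma normr_Re_le z : `|complex.Re z| <= modulus z.
Proof. by case: z => x y; rewrite /modulus /= -sqrtr_sqr ler_wsqrtr // lerDl sqr_ge0. Qed.
Lemma normr_Im_le z : `|complex.Im z| <= modulus z.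
Proof. by case: z => x y; rewrite /modulus /= -sqrtr_sqr ler_wsqrtr // lerDr sqr_ge0. Qed.
Lemma modulus_le_ReIm z : modulus z <= `|complex.Re z| + `|complex.Im z|.
Proof.
case: z => x y; rewrite /modulus /= -(ger0_norm (addr_ge0 (normr_ge0 x) (normr_ge0 y))).
rewrite -sqrtr_sqr ler_wsqrtr // sqrrD !real_normK ?num_real // addrAC lerDl.
by rewrite mulrn_wge0 // mulr_ge0.
Qed.
End Modulus.

#[local] Existing Instance summability.totally_filter.

Section UnconditionalSums.
Variables (R : realType) (I : choiceType).

Definition csum_to (F : I -> R[i]) (l : R[i]) := forall eps : R, 0 < eps ->
  exists S : {fset I}, forall S' : {fset I}, fsubset S S' ->
    modulus (\sum_(x <- S') F x - l) < eps.

Lemma sums_toP s (F : I -> 'rV[R[i]]_s) (l : 'rV[R[i]]_s) :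
  sums_to F l <-> forall i, csum_to (fun x => F x 0 i) (l 0 i).
Proof.
have sumE S' i : summability.partial_sum F S' 0 i = \sum_(x <- S') F x 0 i.
  by rewrite /summability.partial_sum summxE (big_seq_fsetE _ S' xpredT (fun x => F x 0 i)).
rewrite /sums_to; split=> [/cvg_ballP Fl i eps eps0|Fl].
  have /= := Fl eps%:C; rewrite ltcR => /(_ eps0)[S _ HS].
  exists S => S' SS'; have [_ /(_ 0 i)] := HS S' SS'.
  by rewrite /ball /= sumE distrC normr_modulus ltcR.
apply/cvg_ballP => eps eps0.
have epsE : eps = (complex.Re eps)%:C by rewrite RRe_real // gtr0_real.
have {}eps0 : 0 < complex.Re eps by rewrite -ltcR -epsE.
have /choice[S HS] i := Fl i _ eps0.
exists (\big[@fsetU I/fset0]_(i : 'I_s) S i) => // S' /= SS'; rewrite epsE; split; first by rewrite ltcR.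
move=> j i; rewrite /ball /= (ord1 j) sumE distrC normr_modulus ltcR; apply: HS.
by apply: fsubset_trans SS'; apply: bigfcup_sup => //; rewrite mem_index_enum.
Qed.

Lemma big_fset_split (V : nmodType) (S S' : {fset I}) (F : I -> V) : fsubset S S' ->
  \sum_(x <- S') F x = \sum_(x <- S) F x + \sum_(x <- fsetD S' S) F x.
Proof.
move=> SS'; rewrite (big_fsetID _ (fun x => x \in S)) /=; congr (_ + _); apply: eq_fbigl => x.
  by rewrite !inE /=; apply/andP/idP => [[]//|xS]; rewrite (fsubsetP SS').
by rewrite !inE /= andbC.
Qed.

(** The Cauchy criterion for absolute summability. *)
Definition small_tails (F : I -> R[i]) := forall eps : R, 0 < eps ->
  exists S : {fset I}, forall T : {fset I}, fdisjoint S T ->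
    \sum_(x <- T) modulus (F x) <= eps.

(** Unconditional convergence makes all finite sums away from some S small. Splitting by the sign of
    the real part, and likewise of the imaginary part, turns this into smallness of the sums of
    moduli. *)
Lemma csum_to_small_tails F l : csum_to F l -> small_tails F.
Proof.
(* Two partial sums within eps / 8 of the limit differ by at most eps / 4, and there are four sign
   classes. *)
move=> Fl eps eps0; have eps8 : 0 < eps / 8%:R by rewrite divr_gt0.
have [S HS] := Fl _ eps8; exists S => T0 ST0.
have small (T : {fset I}) : fsubset T T0 -> modulus (\sum_(x <- T) F x) <= eps / 4%:R.
  move=> TT0; have ST : fdisjoint S T by apply: fdisjointWr ST0.
  have := HS _ (fsubsetUl S T); rewrite (big_fset_split _ (fsubsetUl S T)).
  rewrite fsetDUl fsetDv fset0U (fsetDidPl _ _ _); last by rewrite fdisjoint_sym.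
  have := HS _ (fsubset_refl S); set A := \sum_(x <- S) F x; set B := \sum_(x <- T) F x.
  move=> HA HB; have -> : B = (A + B - l) - (A - l) by ring.
  by apply: le_trans (ler_modulusB _ _) _; lra.
have real_part (g : R[i] -> R) : {morph g : z w / z + w} -> (forall z, `|g z| <= modulus z) ->
    \sum_(x <- T0) `|g (F x)| <= eps / 2%:R.
  move=> gD gle; have g0 : g 0 = 0 by have := gle 0; rewrite modulus0 normr_le0 => /eqP.
  rewrite (big_fsetID _ (fun x => 0 <= g (F x))) /=.
  have -> : eps / 2%:R = eps / 4%:R + eps / 4%:R by field.
  apply: lerD.
    have := small [fset x in T0 | 0 <= g (F x)]%fset (fset_sub _ _).
    apply: le_trans; apply: le_trans (gle _); rewrite (big_morph g gD g0).
    apply: le_trans (ler_norm _); rewrite big_seq [leRHS]big_seq.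
    by apply: ler_sum => x; rewrite !inE => /andP[_ /= /ger0_norm ->].
  have := small [fset x in T0 | ~~ (0 <= g (F x))]%fset (fset_sub _ _).
  apply: le_trans; apply: le_trans (gle _); rewrite (big_morph g gD g0).
  rewrite -normrN; apply: le_trans (ler_norm _); rewrite -sumrN big_seq [leRHS]big_seq.
  by apply: ler_sum => x; rewrite !inE => /andP[_ /=]; rewrite -ltNge => /ltr0_norm ->.
apply: le_trans (ler_sum _ (fun x _ => modulus_le_ReIm (F x))) _.
rewrite big_split /=; have -> : eps = eps / 2%:R + eps / 2%:R by field.
apply: lerD; apply: real_part; [exact: raddfD | exact: normr_Re_le | exact: raddfD |
  exact: normr_Im_le].
Qed.

Lemma csum_to_le F l (L : R[i]) (b : R) (S : {fset I}) : csum_to F l ->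
  (forall S', fsubset S S' -> modulus (\sum_(x <- S') F x - L) <= b) ->
  modulus (l - L) <= b.
Proof.
move=> Fl Fb; apply/ler_addgt0Pr => eps /Fl[S0 HS0].
have := HS0 _ (fsubsetUl S0 S); have := Fb _ (fsubsetUr S0 S).
set A := \sum_(x <- _) F x => Ab Al; have -> : l - L = (A - L) - (A - l) by ring.
by apply: le_trans (ler_modulusB _ _) _; rewrite lerD // ltW.
Qed.

Lemma small_tails_bounded F : small_tails F ->
  exists b : R, forall S : {fset I}, \sum_(x <- S) modulus (F x) <= b.
Proof.
move=> /(_ 1 ltr01)[S HS]; exists (\sum_(x <- S) modulus (F x) + 1) => S'.
rewrite (big_fset_split _ (fsubsetIl S' S)) lerD //.
  rewrite [leRHS](big_fset_split _ (fsubsetIr S' S)) lerDl.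
  by apply: sumr_ge0 => x _; apply: modulus_ge0.
by apply: HS; apply/fdisjointP => x xS; rewrite !inE xS andbT negb_and orNb.
Qed.
End UnconditionalSums.

Lemma csum_to_power_series (R : realType) s (a : multinom s -> 'rV[R[i]]_s)
    (z w : 'rV[R[i]]_s) i : sums_to (power_series_term a z) w ->
  csum_to (fun m => a m 0 i * mmap1 (z 0) m) (w 0 i).
Proof.
move=> /sums_toP /(_ i) fz eps /fz[S HS]; exists S => S' /HS.
by under eq_bigr do rewrite mxE mulrC.
Qed.

(** * Substitution into a power series *)

Section Composition.
Variables (R : realType) (d : nat) (x : 'I_d -> R[i]).
Implicit Types P Q : mpoly d R[i].

(** The l^1 norm of the coefficients with weights |x^n|. It is submultiplicative, which controls the
    powers of Q in the double series. *)
Definition majorant Q : R := \sum_(n <- msupp Q) modulus (mcoeff n Q * mmap1 x n).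

Lemma majorantE Q (r : seq (multinom d)) : uniq r -> {subset msupp Q <= r} ->
  majorant Q = \sum_(n <- r) modulus (mcoeff n Q * mmap1 x n).
Proof.
move=> r_uniq Qr; rewrite [RHS](bigID (mem (msupp Q))) /= [X in _ + X]big1 ?addr0.
  rewrite -[RHS]big_filter; apply: perm_big; apply: uniq_perm; rewrite ?filter_uniq ?msupp_uniq //.
  by move=> n; rewrite mem_filter /= andbC; case: (boolP (n \in msupp Q)) => [/Qr->|_]; rewrite ?andbF.
by move=> n /memN_msupp_eq0 ->; rewrite mul0r modulus0.
Qed.

Lemma majorant_ge0 Q : 0 <= majorant Q.
Proof. by apply: sumr_ge0 => n _; apply: modulus_ge0. Qed.

Lemma majorantD P Q : majorant (P + Q) <= majorant P + majorant Q.
Proof.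
pose r := undup (msupp P ++ msupp Q).
have r_uniq : uniq r by apply: undup_uniq.
rewrite (@majorantE (P + Q) r) ?(@majorantE P r) ?(@majorantE Q r) //.
- rewrite -big_split /=; apply: ler_sum => n _; rewrite mcoeffD mulrDl; exact: ler_modulusD.
- by move=> n; rewrite mem_undup mem_cat => ->; rewrite orbT.
- by move=> n; rewrite mem_undup mem_cat => ->.
by move=> n /msuppD_le; rewrite mem_undup.
Qed.

Lemma majorant_sum (I : Type) (r : seq I) (F : I -> mpoly d R[i]) :
  majorant (\sum_(i <- r) F i) <= \sum_(i <- r) majorant (F i).
Proof.
elim/big_rec2: _ => [|i y Q _ Qy]; first by rewrite /majorant msupp0 big_nil.
by apply: le_trans (majorantD _ _) _; rewrite lerD2l.
Qed.

Lemma majorantZX c m Q :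
  majorant (Q * (c *: mpolyX R[i] m)) = modulus (c * mmap1 x m) * majorant Q.
Proof.
rewrite -scalerAr (@majorantE _ [seq mnm_add m m' | m' <- msupp Q]).
- rewrite big_map mulr_sumr; apply: eq_bigr => n _.
  by rewrite mcoeffZ mcoeffMX mmap1D -modulusM; congr modulus; ring.
- by rewrite map_inj_uniq ?msupp_uniq //; apply: addmI.
by move=> n /msuppZ_le; rewrite (perm_mem (msuppMX _ _)).
Qed.

Lemma majorantM P Q : majorant (P * Q) <= majorant P * majorant Q.
Proof.
rewrite {1}[P]mpolyE mulrC mulr_sumr; apply: le_trans (majorant_sum _ _) _.
by rewrite mulr_suml; apply: ler_sum => m _; rewrite majorantZX.
Qed.

Lemma majorant1 : majorant 1 = 1.
Proof. by rewrite /majorant msupp1 big_seq1 mmap11 mulr1 mcoeff1 eqxx modulus1. Qed.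

Lemma majorant_mmap1 (s : nat) (Q : 'I_s -> mpoly d R[i]) (zhat : 'I_s -> R) m :
  (forall i, majorant (Q i) <= zhat i) ->
  majorant (mmap1 Q m) <= mmap1 zhat m.
Proof.
move=> Qz; elim/mnm_ind: m => [|j m IHm]; first by rewrite !mmap11 majorant1.
rewrite !mmap1D !mmap1U; apply: le_trans (majorantM _ _) _.
by rewrite ler_pM ?majorant_ge0.
Qed.

Lemma majorant_fset Q (E : {fset multinom d}) :
  modulus (\sum_(n <- E) mcoeff n Q * mmap1 x n) <= majorant Q.
Proof.
apply: le_trans (ler_modulus_sum _ _ _) _.
rewrite (@majorantE Q (undup (enum_fset E ++ msupp Q))) ?undup_uniq //; last first.
  by move=> n nQ; rewrite mem_undup mem_cat nQ orbT.
rewrite [leRHS](bigID (fun n => n \in E)) /= -[leLHS]addr0 lerD //; last first.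
  by apply: sumr_ge0 => n _; apply: modulus_ge0.
rewrite -[leRHS]big_filter le_eqVlt; apply/orP; left; apply/eqP; apply: perm_big; apply: uniq_perm.
- exact: fset_uniq.
- by rewrite filter_uniq ?undup_uniq.
by move=> n; rewrite mem_filter mem_undup mem_cat; case: (n \in E).
Qed.

Lemma sum_fset_meval Q (E : {fset multinom d}) : {subset msupp Q <= E} ->
  \sum_(n <- E) mcoeff n Q * mmap1 x n = meval x Q.
Proof.
move=> QE; rewrite mevalE -[RHS]/(\sum_(n <- msupp Q) mcoeff n Q * mmap1 x n).
rewrite (bigID (mem (msupp Q))) /= [X in _ + X]big1 ?addr0; last first.
  by move=> n /memN_msupp_eq0 ->; rewrite mul0r.
rewrite -big_filter; apply: perm_big; apply: uniq_perm; rewrite ?filter_uniq ?msupp_uniq ?fset_uniq //.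
by move=> n; rewrite mem_filter /=; case: (boolP (n \in msupp Q)) => [/QE->|].
Qed.

Lemma meval_mmap1 (s : nat) (Q : 'I_s -> mpoly d R[i]) m :
  meval x (mmap1 Q m) = mmap1 (fun i => meval x (Q i)) m.
Proof.
elim/mnm_ind: m => [|j m IHm]; first by rewrite !mmap11 meval1.
by rewrite !mmap1D !mmap1U mevalM IHm.
Qed.

Definition bounded_mnms s B : {fset multinom s} :=
  seq_fset tt [seq bmnm m | m <- index_enum (bmultinom s B)].

Lemma mem_bounded_mnms s B m : (m \in bounded_mnms s B) = (mdeg m < B)%N.
Proof.
rewrite seq_fsetE; apply/mapP/idP => [[m' _ ->]|mB]; first exact: bmdeg.
by exists (BMultinom mB); rewrite // mem_index_enum.
Qed.

Lemma sum_bounded_mnms s B (V : nmodType) (F : multinom s -> V) :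
  \sum_(m <- bounded_mnms s B) F m = \sum_(m : bmultinom s B) F m.
Proof.
rewrite -(big_map (@bmnm s B) xpredT F); apply: perm_big; apply: uniq_perm.
- exact: fset_uniq.
- rewrite map_inj_uniq ?index_enum_uniq // => m1 m2 m12; apply/eqP; rewrite bmeqP m12 //.
by move=> m; rewrite seq_fsetE.
Qed.

(** Interchange of the sums over m and n. For m in a large finite set the powers of Q are summed
    completely over n and give the series at Q(x); the other m are dominated by the series at
    [zhat]. *)
Lemma csum_to_composition (s : nat) (a : multinom s -> R[i]) (Q : 'I_s -> mpoly d R[i])
    (zhat : 'I_s -> R) (l : R[i]) :
  (forall i, coef_from 1 (Q i)) -> (forall i, majorant (Q i) <= zhat i) ->
  small_tails (fun m => a m * (mmap1 zhat m)%:C) ->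
  csum_to (fun m => a m * mmap1 (fun i => meval x (Q i)) m) l ->
  csum_to (fun n => mmap1 x n * \sum_(m : bmultinom s (mdeg n).+2) a m * mcoeff n (mmap1 Q m)) l.
Proof.
move=> Q1 Qz a_small a_sum eps eps0; have eps2 : 0 < eps / 2%:R by rewrite divr_gt0.
have [S1 HS1] := a_small _ eps2; have [S2 HS2] := a_sum _ eps2.
pose S := fsetU S1 S2.
(* Any [E] above this set contains every monomial of the powers of Q with exponent in [S]. *)
exists (\big[@fsetU _/fset0]_(m <- S) seq_fset tt (msupp (mmap1 Q m))) => E SE.
have SE' m : m \in S -> {subset msupp (mmap1 Q m) <= E}.
  move=> mS n nm; apply: (fsubsetP SE).
  by apply/bigfcupP; exists m; rewrite ?mS ?seq_fsetE.
(* [B] bounds all inner ranges at once. The added m have |m| > |n| and contribute 0, because Q has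
   no constant term. *)
pose B := (\max_(n <- E) (mdeg n).+2)%N.
pose D := fsetU S (bounded_mnms s B).
have -> : \sum_(n <- E) mmap1 x n * (\sum_(m : bmultinom s (mdeg n).+2) a m * mcoeff n (mmap1 Q m)) =
    \sum_(m <- D) a m * (\sum_(n <- E) mcoeff n (mmap1 Q m) * mmap1 x n).
  under [RHS]eq_bigr do rewrite mulr_sumr.
  rewrite [RHS]exchange_big /=; apply: eq_big_seq => n nE.
  rewrite -(sum_bounded_mnms _ (fun m => a m * mcoeff n (mmap1 Q m))) mulr_sumr.
  under [RHS]eq_bigr do rewrite mulrA [_ * mmap1 x n]mulrC.
  apply: big_fset_incl => [|m mD].
    apply/fsubsetP => m; rewrite in_fsetU !mem_bounded_mnms => mn; apply/orP; right.
    by apply: leq_trans mn _; rewrite /B (big_rem n) //= leq_maxl.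
  rewrite mem_bounded_mnms -leqNgt => nm.
  rewrite (coef_from_mmap1 (m := m) Q1) ?mulr0 //; exact: ltnW.
rewrite (big_fset_split _ (fsubsetUl S _)).
under eq_big_seq => m mS do rewrite (sum_fset_meval (SE' m mS)) meval_mmap1.
rewrite addrAC; apply: le_lt_trans (ler_modulusD _ _) _.
have -> : eps = eps / 2%:R + eps / 2%:R by field.
rewrite ltr_leD ?HS2 ?fsubsetUr //; apply: le_trans (ler_modulus_sum _ _ _) _.
apply: le_trans (HS1 (fsetD D S) _); last first.
  by apply/fdisjointP => m mS1; rewrite !inE mS1.
apply: ler_sum => m _; rewrite !modulusM modulus_real ler_wpM2l ?modulus_ge0 //.
apply: le_trans (majorant_fset _ _) _; apply: le_trans (majorant_mmap1 m Qz) _.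
exact: ler_norm.
Qed.
End Composition.

(** * The linear part of a power series *)

Section LinearPart.
Variables (R : realType) (s : nat).
Local Notation C := R[i].

Lemma ler_mx_norm (K : numDomainType) m n (x : 'M[K]_(m, n)) i j : `|x i j| <= `|x|.
Proof.
rewrite [leRHS]mx_normE.
exact: (@le_bigmax _ _ _ _ (fun k : 'I_m * 'I_n => `|x k.1 k.2|%:nng) (i, j)).
Qed.

Lemma mx_norm_ler (K : numDomainType) m n (x : 'M[K]_(m, n)) c : 0 <= c ->
  (forall i j, `|x i j| <= c) -> `|x| <= c.
Proof.
move=> c0 xc; have [->//|x0] := eqVneq `|x| 0.
by have [[i j] /= xE] := mx_norm_neq0 x0; rewrite -[leLHS]/(mx_norm x) xE.
Qed.

Lemma nbhs0_mx_norm_le (K : numFieldType) m n (e : K) : 0 < e ->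
  \forall x \near nbhs (0 : 'M[K]_(m, n)), `|x| <= e.
Proof.
move=> e0; apply/nbhs_ballP; exists e => // x [_ xe]; apply: mx_norm_ler => [|i j]; first exact: ltW.
by have := xe i j; rewrite /ball /= mxE sub0r normrN => /ltW.
Qed.

Lemma mulmxr_continuous (K : numFieldType) m n (M : 'M[K]_(m, n)) :
  continuous (mulmxr M : 'rV[K]_m -> 'rV[K]_n).
Proof.
apply/linear_bounded_continuous/ex_bound; exists (\sum_k \sum_i `|M k i|).
near=> h; have h1 : `|h| <= 1 by near: h; apply: nbhs0_mx_norm_le.
have M0 k : 0 <= \sum_i `|M k i| by apply: sumr_ge0.
apply: mx_norm_ler => [|i j]; first exact: sumr_ge0.
rewrite mxE; apply: le_trans (ler_norm_sum _ _ _) _; apply: ler_sum => k _.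
rewrite normrM -[leRHS]mul1r ler_pM //; first exact: le_trans (ler_mx_norm h i k) h1.
by rewrite (bigD1 j) //= lerDl; apply: sumr_ge0.
Unshelve. all: by end_near. Qed.

Variables (f : 'rV[C]_s -> 'rV[C]_s) (a : multinom s -> 'rV[C]_s) (rho : R).
Hypotheses (rho0 : 0 < rho) (f0 : f 0 = 0).
Hypothesis fa : forall z, polydisc rho z -> sums_to (power_series_term a z) (f z).

(** At z = 0 every partial sum that contains the index 0 equals a_0, and the limit is f 0 = 0. *)
Lemma power_series_coef0 : a (@mnm0 s) = 0.
Proof.
apply/rowP => i; rewrite mxE.
have z0 : polydisc rho (0 : 'rV[C]_s) by move=> j; rewrite mxE modulus0.
have := csum_to_le (L := a (@mnm0 s) 0 i) (b := 0) (S := [fset @mnm0 s]%fset)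
  (csum_to_power_series i (fa z0)).
rewrite f0 [(0 : 'rV[C]_s) 0 i]mxE sub0r modulusN => H; apply/eqP.
rewrite -modulus_eq0 eq_le modulus_ge0 andbT; apply: H => S' /fsubsetP SS'.
rewrite (big_fsetD1 (@mnm0 s)) /=; last by rewrite SS' // inE.
rewrite mmap11 mulr1 addrC addrK big_seq big1 ?modulus0 // => m.
rewrite !inE -mdeg_eq0 mdegE => /andP[+ _]; rewrite sum_nat_eq0 => /forallPn[j]; rewrite implyTb => mj.
by rewrite /mmap1 (bigD1 j) //= mxE expr0n (negPf mj) mul0r mulr0.
Qed.

(** Comparison with the absolutely convergent series at the point with all coordinates r = rho / 2:
    for |m| >= 2 and t <= r, the term at v is at most (t / r)^2 times the term there. *)
Lemma power_series_linear_approx i : exists2 b : R, 0 < b &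
  forall (v : 'rV[C]_s) (t : R), 0 <= t <= rho / 2%:R -> (forall j, modulus (v 0 j) <= t) ->
    modulus (f v 0 i - \sum_j a (mnm1 j) 0 i * v 0 j) <= t ^+ 2 * b.
Proof.
pose r := rho / 2%:R; have r0 : 0 < r by rewrite divr_gt0.
have r_lt : r < rho by rewrite /r ltr_pdivrMr // mulr_natr mulr2n ltrDl.
pose w : 'rV[C]_s := const_mx r%:C.
have w_disc : polydisc rho w by move=> j; rewrite mxE modulus_real gtr0_norm.
have [B HB] := small_tails_bounded (csum_to_small_tails (csum_to_power_series i (fa w_disc))).
have B0 : 0 <= B by have := HB fset0; rewrite big_seq_fset0.
exists ((B + 1) / r ^+ 2); first by rewrite divr_gt0 ?exprn_gt0 // ltr_wpDl.
move=> v t /andP[t0 tr] vt.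
have v_disc : polydisc rho v by move=> j; apply: le_lt_trans (vt j) (le_lt_trans tr r_lt).
apply: (csum_to_le (S := bounded_mnms s 2) (csum_to_power_series i (fa v_disc))) => S' SS'.
rewrite (big_fset_split _ SS') sum_bounded_mnms.
rewrite (sum_bmultinom_split _ (F := fun m => a m 0 i * mmap1 (v 0) m)); last first.
  by rewrite power_series_coef0 mxE mul0r.
rewrite [X in _ + X + _ - _]big1 ?addr0 => [|m m2]; last by have := bmdeg m; rewrite ltnNge m2.
under eq_bigr do rewrite mmap1U.
rewrite addrC addrA addNr add0r; apply: le_trans (ler_modulus_sum _ _ _) _.
apply: (@le_trans _ _ (\sum_(m <- fsetD S' (bounded_mnms s 2))
    (t / r) ^+ 2 * modulus (a m 0 i * mmap1 (w 0) m))).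
  rewrite big_seq [leRHS]big_seq; apply: ler_sum => m; rewrite in_fsetD mem_bounded_mnms -leqNgt => /andP[m2 _].
  rewrite !modulusM mulrCA ler_wpM2l ?modulus_ge0 // /mmap1 !modulus_prod.
  under [X in _ <= _ * X]eq_bigr do rewrite modulusX mxE modulus_real (gtr0_norm r0).
  under eq_bigr do rewrite modulusX.
  rewrite prodrXr -mdegE; apply: (@le_trans _ _ (t ^+ mdeg m)).
    rewrite mdegE -prodrXr; apply: ler_prod => j _.
    by rewrite exprn_ge0 ?modulus_ge0 //= lerXn2r ?nnegrE ?modulus_ge0.
  rewrite -[t in leLHS](divfK (lt0r_neq0 r0)) exprMn ler_wpM2r ?exprn_ge0 ?(ltW r0) //.
  apply: ler_wiXn2l; [by rewrite divr_ge0 // ltW | by rewrite ler_pdivrMr // mul1r | exact: m2].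
rewrite -mulr_sumr expr_div_n -mulrA ler_wpM2l ?exprn_ge0 // mulrC.
rewrite ler_wpM2r ?invr_ge0 ?exprn_ge0 ?(ltW r0) //.
by apply: le_trans (HB _) _; rewrite lerDl.
Qed.

(** The quadratic error bound identifies the differential by uniqueness; this links the spectral
    hypotheses on Df(0) to the coefficients of the series. *)
Lemma jacobian_power_series j i : jacobian f 0 j i = a (mnm1 j) 0 i.
Proof.
pose M : 'M[C]_s := \matrix_(k, l) a (mnm1 k) 0 l.
have /choice[b Hb] l : exists b : R, 0 < b /\ forall (v : 'rV[C]_s) (t : R),
    0 <= t <= rho / 2%:R -> (forall j, modulus (v 0 j) <= t) ->
    modulus (f v 0 l - \sum_j a (mnm1 j) 0 l * v 0 j) <= t ^+ 2 * b.
  by have [b b0 Hb] := power_series_linear_approx l; exists b.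
pose B := 1 + \sum_l b l.
have b0 l : 0 < b l by have [] := Hb l.
have B0 : 0 < B by rewrite ltr_wpDr // sumr_ge0 // => l _; apply: ltW.
have bB l : b l <= B.
  rewrite /B (bigD1 l) //= addrCA lerDl addr_ge0 // sumr_ge0 // => k _; exact: ltW.
have dfE : 'd f 0 = mulmxr M :> ('rV[C]_s -> 'rV[C]_s).
  apply: diff_unique; first exact: mulmxr_continuous.
  apply/eqaddoP => eps eps0; rewrite f0.
  have epsE : eps = (complex.Re eps)%:C by rewrite RRe_real // gtr0_real.
  have {}eps0 : 0 < complex.Re eps by rewrite -ltcR -epsE.
  near=> h.
  have hE : `|h| = (complex.Re `|h|)%:C by rewrite RRe_real // ger0_real.
  set t := complex.Re `|h| in hE.
  have t0 : 0 <= t by rewrite -lecR -hE; exact: normr_ge0.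
  have ht k : modulus (h 0 k) <= t by rewrite -lecR -hE -normr_modulus ler_mx_norm.
  have tr : t <= rho / 2%:R.
    rewrite -lecR -hE; near: h; apply: nbhs0_mx_norm_le; rewrite ltcR divr_gt0 //.
  (* This turns the error t^2 B into at most eps t. *)
  have te : t <= complex.Re eps / B.
    rewrite -lecR -hE; near: h; apply: nbhs0_mx_norm_le; rewrite ltcR divr_gt0 //.
  apply: mx_norm_ler => [|k l]; first by rewrite epsE hE -rmorphM lecR mulr_ge0 // ltW.
  rewrite (ord1 k) hE epsE -rmorphM normr_modulus lecR.
  have -> : (f \o shift 0 - (cst 0 + mulmxr M : 'rV[C]_s -> 'rV[C]_s)) h 0 l =
      f h 0 l - \sum_j a (mnm1 j) 0 l * h 0 j.
    rewrite /= !fctE /= addr0 add0r !mxE; congr (_ - _).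
    by apply: eq_bigr => q _; rewrite !mxE mulrC.
  have [_ /(_ h t)] := Hb l; rewrite t0 tr => /(_ isT ht) /le_trans; apply.
  rewrite expr2 mulrAC ler_wpM2r //; apply: le_trans (_ : t * B <= _).
    by rewrite ler_wpM2l.
  by rewrite -ler_pdivlMr.
by rewrite /jacobian mxE dfE /= -rowE !mxE.
Unshelve. all: by end_near. Qed.
End LinearPart.

(** * Logarithmic terms near the origin *)

Section NearZero.
Variables (R : realType) (d : nat).
Local Notation C := R[i].

(** Allows finitely many smallness conditions to be combined by filters, without explicit radii. *)
Lemma near_polydisc (Q : 'rV[C]_d -> Prop) :
  (\forall x \near nbhs (0 : 'rV[(C : numFieldType)]_d), Q x) <->
  exists2 delta : R, 0 < delta & forall x, polydisc delta x -> Q x.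
Proof.
split=> [/nbhs_ballP[e /= e0 He]|[delta delta0 Hd]].
  have eE : e = (complex.Re e)%:C by rewrite RRe_real // gtr0_real.
  exists (complex.Re e); first by rewrite -ltcR -eE.
  move=> x xe; apply: He; split=> // i j.
  by rewrite /ball /= mxE sub0r normrN normr_modulus eE ltcR (ord1 i).
apply/nbhs_ballP; exists delta%:C => /=; first by rewrite ltcR.
move=> x [_ xd]; apply: Hd => j; have := xd 0 j.
by rewrite /ball /= mxE sub0r normrN normr_modulus ltcR.
Qed.

(** With t = exp(-s) and exp(s) >= s^(b+1) / (b+1)!, the product t |nu s|^b is at most c / s. *)
Lemma pow_ln_small (nu : R) (a b : nat) (eps : R) : (0 < a)%N -> 0 < eps ->
  exists2 delta : R, 0 < delta &
    forall t, 0 <= t < delta -> t ^+ a * `|nu * ln t| ^+ b <= eps.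
Proof.
move=> a0 eps0; pose c := `|nu| ^+ b * (b.+1)`!%:R.
have c0 : 0 <= c by rewrite mulr_ge0 ?exprn_ge0.
pose s0 := c / eps + 1; have s0_gt0 : 0 < s0 by rewrite ltr_wpDl // divr_ge0 // ltW.
exists (expR (- s0)) => [|t /andP[t_ge0 t_lt]]; first exact: expR_gt0.
(* At t = 0 the power of t vanishes, whatever value [ln 0] has. *)
have [->|t_neq0] := eqVneq t 0; first by rewrite expr0n gtn_eqF // mul0r ltW.
have t0 : 0 < t by rewrite lt_def t_neq0.
pose s := - ln t; have tE : t = expR (- s) by rewrite /s opprK lnK.
have s_gt : s0 < s by rewrite -ltrN2 -ltr_expR -tE.
have s_gt0 : 0 < s by apply: lt_trans s_gt.
have t1 : t <= 1 by rewrite tE -expR0 ler_expR oppr_le0 ltW.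
apply: (@le_trans _ _ (t * `|nu * ln t| ^+ b)).
  by rewrite ler_wpM2r ?exprn_ge0 // ler_iXnr // t_ge0.
have -> : ln t = - s by rewrite opprK.
rewrite normrM normrN (gtr0_norm s_gt0) exprMn -(ler_pM2r s_gt0).
have exp_ge : s ^+ b.+1 <= (b.+1)`!%:R * expR s.
  have := expR_ge1Dxn b (ltW s_gt0); rewrite -ler_pdivrMl ?ltr0n ?fact_gt0 // mulrC.
  by apply: le_trans; rewrite lerDr.
apply: (@le_trans _ _ c); last first.
  by rewrite mulrC -ler_pdivrMr // (le_trans _ (ltW s_gt)) // lerDl.
rewrite mulrCA -!mulrA -exprSr ler_wpM2l ?exprn_ge0 //.
rewrite tE expRN mulrC ler_pdivrMr ?expR_gt0 //.
Qed.

Variables (nu : 'I_d -> R) (v : 'rV[C]_d -> 'I_d -> C).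
Hypothesis v_modulus : forall x l, modulus (v x l) = `|nu l * ln (modulus (x 0 l))|.

(** The product splits by coordinate. By the support condition a logarithm occurs only next to a
    positive power of the same coordinate; all factors are at most 1, and one with n_j > 0 is at
    most eps. *)
Lemma log_monomial_small (n m : multinom d) (eps : R) : n != @mnm0 d ->
  (forall l, (0 < m l)%N -> (0 < n l)%N) -> 0 < eps ->
  \forall x \near nbhs (0 : 'rV[(C : numFieldType)]_d),
    modulus (mmap1 ((x : 'rV[C]_d) 0) n * mmap1 (v x) m) <= eps.
Proof.
move=> n0 mn eps0.
have [j0 nj0] : exists j, (0 < n j)%N.
  apply/existsP; apply: contraNT n0 => /existsPn n0; apply/eqP/mnmP => i.
  by rewrite mnm0E; apply/eqP; rewrite -leqn0 leqNgt n0.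
pose e := Num.min eps 1; have e0 : 0 < e by rewrite lt_min eps0 ltr01.
have small j : \forall x \near nbhs (0 : 'rV[(C : numFieldType)]_d), (0 < n j)%N ->
    modulus ((x : 'rV[C]_d) 0 j) ^+ n j * modulus (v x j) ^+ m j <= e.
  have [->|nj] := posnP (n j); first by apply: nearW.
  have [delta delta0 Hd] := pow_ln_small (nu j) (m j) nj e0.
  apply/near_polydisc; exists delta => // x xd _; rewrite v_modulus; apply: Hd.
  by rewrite modulus_ge0; apply: xd.
near=> x.
have smallx j : (0 < n j)%N -> modulus (x 0 j) ^+ n j * modulus (v x j) ^+ m j <= e.
  by move: j; near: x; apply: filter_forall => j; apply: small.
have le1 j : modulus (x 0 j) ^+ n j * modulus (v x j) ^+ m j <= 1.
  have [nj|nj] := posnP (n j); last by apply: le_trans (smallx j nj) _; rewrite ge_min lexx orbT.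
  have [->|/mn] := posnP (m j); last by rewrite nj.
  by rewrite nj mulr1.
rewrite /mmap1 -big_split modulus_prod /= (bigD1 j0) //=.
under eq_bigr do rewrite modulusM !modulusX.
rewrite modulusM !modulusX -[leRHS]mulr1; apply: ler_pM.
- by rewrite mulr_ge0 ?exprn_ge0 ?modulus_ge0.
- by apply: prodr_ge0 => j _; rewrite mulr_ge0 ?exprn_ge0 ?modulus_ge0.
- by apply: le_trans (smallx j0 nj0) _; rewrite ge_min lexx.
by apply: prodr_ile1 => j; rewrite le1 mulr_ge0 ?exprn_ge0 ?modulus_ge0.
Unshelve. all: by end_near. Qed.

Lemma log_term_small (n : multinom d) k (q : mpoly d C) (eps : R) : n != @mnm0 d ->
  log_bounded n k q -> 0 < eps ->
  \forall x \near nbhs (0 : 'rV[(C : numFieldType)]_d), modulus (meval (v x) q * mmap1 ((x : 'rV[C]_d) 0) n) <= eps.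
Proof.
move=> n0 Hq; rewrite [q]mpolyE big_seq; move: eps.
elim/big_ind: _ => [eps eps0|q1 q2 H1 H2 eps eps0|m].
- by apply: nearW => x; rewrite meval0 mul0r modulus0 ltW.
- have eps2 : 0 < eps / 2%:R by rewrite divr_gt0.
  have [H1' H2'] := (H1 _ eps2, H2 _ eps2).
  near=> x; rewrite mevalD mulrDl; apply: le_trans (ler_modulusD _ _) _.
  have -> : eps = eps / 2%:R + eps / 2%:R by field.
  by apply: lerD; near: x.
rewrite mcoeff_msupp => mq eps eps0; have [_ mn] := Hq m mq.
have q0 : 0 < modulus (mcoeff m q) by rewrite lt_def modulus_ge0 modulus_eq0 mq.
have := log_monomial_small n0 mn (divr_gt0 eps0 q0).
apply: filterS => x; rewrite ler_pdivlMr // mevalZ mevalX -modulusM; apply: le_trans.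
by rewrite le_eqVlt; apply/orP; left; apply/eqP; congr modulus; rewrite /mmap1; ring.
Unshelve. all: by end_near. Qed.
End NearZero.

Lemma meval_log_bounded (K : numFieldType) (d : nat) n k (q : mpoly d K) (v w : 'I_d -> K) :
  log_bounded n k q -> (forall l, (0 < n l)%N -> v l = w l) -> meval v q = meval w q.
Proof.
move=> Hq vw; rewrite !mevalE; apply: eq_big_seq => m; rewrite mcoeff_msupp => /Hq[_ mn].
congr (_ * _); apply: eq_bigr => l _.
by have [->|/mn/vw->//] := posnP (m l); rewrite !expr0.
Qed.

(** Passes from the full expansion of f(h(x)) to its tail of degree at least N. *)
Lemma csum_to_remove (R : realType) (I : choiceType) (F : I -> R[i]) l (B : {fset I}) :
  csum_to F l ->
  csum_to (fun x => if x \in B then 0 else F x) (l - \sum_(x <- B) F x).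
Proof.
move=> Fl eps /Fl[S HS]; exists (fsetU S B) => S'; rewrite fsubUset => /andP[SS' BS'].
have := HS S' SS'; rewrite (big_fset_split _ BS'); congr (modulus _ < _).
rewrite [in RHS](big_fset_split _ BS') [X in _ = X + _ - _]big_seq.
rewrite [X in _ = X + _ - _]big1 => [|x ->//].
rewrite add0r; have -> : \sum_(x <- fsetD S' B) (if x \in B then 0 else F x) =
    \sum_(x <- fsetD S' B) F x.
  by apply: eq_big_seq => x; rewrite in_fsetD => /andP[/negPf->].
ring.
Qed.

(** * Convergence of the substituted series at a fixed point *)

Section FormalSum.
Variables (R : realType) (s d N : nat) (a : multinom s -> 'rV[R[i]]_s).
Variables (f : 'rV[R[i]]_s -> 'rV[R[i]]_s) (h : multinom d -> 'rV[mpoly d R[i]]_s).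
Hypothesis Hh : log_normed h.

Lemma map_mpoly_mmap1 (v : 'I_d -> R[i]) (P : 'I_s -> mpoly d (mpoly d R[i])) m :
  map_mpoly (meval v) (mmap1 P m) = mmap1 (fun i => map_mpoly (meval v) (P i)) m.
Proof.
elim/mnm_ind: m => [|j m IHm]; first by rewrite !mmap11 rmorph1.
by rewrite !mmap1D !mmap1U rmorphM /= IHm.
Qed.

(** Once the logarithms are frozen to the numbers [v], the components of h are ordinary polynomials
    in x and [csum_to_composition] applies. *)
Lemma csum_to_substitution (x v : 'I_d -> R[i]) (zhat : 'I_s -> R) :
  (forall i, \sum_(n : bmultinom d N) modulus (meval v (h n 0 i) * mmap1 x n) <= zhat i) ->
  (forall z : 'rV[R[i]]_s, (forall i, modulus (z 0 i) <= zhat i) ->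
     sums_to (power_series_term a z) (f z)) ->
  forall i, csum_to (fun n => mmap1 x n * meval v (comp_coef a h N n 0 i))
    (f (\row_j \sum_(n : bmultinom d N) meval v (h n 0 j) * mmap1 x n) 0 i).
Proof.
move=> h_small fa i; set z := \row_j _.
have fa' (w : 'rV[R[i]]_s) : (forall i, modulus (w 0 i) <= zhat i) ->
    csum_to (fun m => a m 0 i * mmap1 (w 0) m) (f w 0 i).
  by move=> /fa; apply: csum_to_power_series.
pose Q j := map_mpoly (meval v) (formal_log_poly h N j).
have QE n j : mcoeff n (Q j) = if (mdeg n < N)%N then meval v (h n 0 j) else 0.
  by rewrite mcoeff_map_mpoly mcoeff_formal_log_poly /=; case: ifP => _; rewrite ?raddf0.
have Q_supp j : {subset msupp (Q j) <= bounded_mnms d N}.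
  move=> n; rewrite mcoeff_msupp QE mem_bounded_mnms; case: ifP => //.
  by rewrite eqxx.
have Q1 j : coef_from 1 (Q j).
  move=> n; rewrite ltnS leqn0 => n0; rewrite QE; case: ifP => // _.
  have -> : h n 0 j = 0; last by rewrite meval0.
  by apply: (@log_bounded_eq0 _ _ n); have := @Hh n j; rewrite (eqP n0).
have Qz j : meval x (Q j) = z 0 j.
  rewrite mxE -(@sum_fset_meval _ _ x (Q j) _ (@Q_supp j)) sum_bounded_mnms.
  by apply: eq_bigr => n _; rewrite QE bmdeg.
have Qmaj j : majorant x (Q j) <= zhat j.
  rewrite (majorantE x (fset_uniq _) (@Q_supp j)).
  apply: le_trans (h_small j); rewrite sum_bounded_mnms.
  by apply: ler_sum => n _; rewrite QE bmdeg.
have zhat0 j : 0 <= zhat j by apply: le_trans (Qmaj j); apply: majorant_ge0.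
have z_le j : modulus (z 0 j) <= zhat j.
  rewrite mxE; apply: le_trans (h_small j); exact: ler_modulus_sum.
(* The second assumption covers the point [zhat] itself, where convergence yields absolute
   summability. *)
have zhat_small : small_tails (fun m => a m 0 i * (mmap1 zhat m)%:C).
  have -> : (fun m => a m 0 i * (mmap1 zhat m)%:C) =
      (fun m => a m 0 i * mmap1 ((\row_j (zhat j)%:C : 'rV[R[i]]_s) 0) m).
    apply/funext => m; congr (_ * _); rewrite /mmap1 rmorph_prod.
    by apply: eq_bigr => j _; rewrite mxE rmorphXn.
  by apply: csum_to_small_tails; apply: fa' => j; rewrite mxE modulus_real ger0_norm.
have := csum_to_composition (x := x) Q1 Qmaj zhat_small (l := f z 0 i).
have -> : (fun m => a m 0 i * mmap1 (fun j => meval x (Q j)) m) =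
    (fun m => a m 0 i * mmap1 (z 0) m).
  by apply/funext => m; congr (_ * _); apply: mmap1_eq.
move=> /(_ (fa' z z_le)) fz eps /fz[S HS]; exists S => S' /HS.
congr (modulus (_ - _) < _); apply: eq_bigr => n _; congr (_ * _).
rewrite mxE raddf_sum; apply: eq_bigr => m _.
by rewrite /= mevalZ -mcoeff_map_mpoly map_mpoly_mmap1.
Qed.
End FormalSum.

(** * The logarithmic variables under the action of A *)

Section LogVariables.
Variables (R : realType) (d : nat) (gamma : R) (lam1 : 'I_d -> R[i]).
Hypothesis lam1_neq0 : forall j, lam1 j != 0.
Hypothesis lam1_lt1 : forall j, modulus (lam1 j) < 1.

Let nu := exponent gamma lam1.
Let eta := log_var nu (1%:M : 'M[R]_d).

Lemma power_coefs1 : power_coefs (1%:M : 'M[R]_d).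
Proof.
split=> [l j|l]; first by rewrite mxE ler0n.
by exists l; rewrite mxE eqxx ltr01.
Qed.

Lemma ln_modulus_lam j : ln (modulus (lam1 j)) < 0.
Proof. by rewrite ln_lt0 // lam1_lt1 andbT lt_def modulus_ge0 modulus_eq0 lam1_neq0. Qed.

Lemma log_var1E x l : eta x l = (nu l * ln (modulus (x 0 l)))%:C.
Proof.
rewrite /eta /log_var /power_fun (bigD1 l) //= big1 ?addr0 => [|j jl].
  by rewrite mxE eqxx mul1r ln_powR.
by rewrite mxE eq_sym (negPf jl) mul0r.
Qed.

(** The exponent nu_l is chosen so that nu_l log |lambda_l| = log gamma. The point x_l = 0 is
    excluded because [ln 0] is 0 by convention. *)
Lemma log_var_diag_action (x : 'rV[R[i]]_d) l : x 0 l != 0 ->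
  eta (diag_action lam1 x) l = eta x l + (ln gamma)%:C.
Proof.
move=> xl; have pos (z : R[i]) : z != 0 -> modulus z \is Num.pos.
  by move=> z0; rewrite posrE lt_def modulus_ge0 modulus_eq0 z0.
rewrite !log_var1E -rmorphD mxE modulusM lnM ?pos // mulrDr addrC; congr (_ + _)%:C.
by rewrite /nu /exponent divfK // lt_eqF // ln_modulus_lam.
Qed.

(** If x_l = 0 for some l with n_l > 0, both sides vanish through x^n; otherwise every logarithm
    that occurs in q is shifted by log gamma. *)
Lemma meval_diag_action n k (q : mpoly d R[i]) (x : 'rV[R[i]]_d) :
  log_bounded n k q ->
  meval (eta (diag_action lam1 x)) q * mmap1 (diag_action lam1 x 0) n =
  mmap1 lam1 n * mmap1 (x 0) n * meval (eta x) (shift_vars (ln gamma)%:C q).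
Proof.
move=> Hq; have -> : mmap1 (diag_action lam1 x 0) n = mmap1 lam1 n * mmap1 (x 0) n.
  by rewrite -big_split /=; apply: eq_bigr => j _; rewrite mxE exprMn.
rewrite mulrC meval_shift_vars.
have [x0|/existsPn x_neq0] := boolP [exists l, (0 < n l)%N && (x 0 l == 0)].
  have -> : mmap1 (x 0) n = 0; last by rewrite mulr0 !mul0r.
  move: x0 => /existsP[l /andP[nl /eqP xl]].
  by rewrite /mmap1 (bigD1 l) //= xl expr0n gtn_eqF // mul0r.
congr (_ * _); apply: meval_log_bounded Hq _ => l nl; apply: log_var_diag_action.
by have := x_neq0 l; rewrite nl.
Qed.

Lemma support_condition1 (s : nat) (H : multinom d -> 'rV[mpoly d R[i]]_s) n k :
  (forall i, log_bounded n k (H n 0 i)) -> support_condition (1%:M : 'M[R]_d) H n.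
Proof.
move=> Hn l [i [m /Hn[_ mn] ml]] j; rewrite mxE; case: eqP => [<- _|_]; first exact: mn.
by rewrite ltxx.
Qed.
End LogVariables.

(** * Degree, value and smallness of the logarithmic polynomial *)

Lemma deg_le_pred_log_bounded (R : realType) (s d : nat) (H : 'rV[mpoly d R[i]]_s) n k :
  (forall i, log_bounded n k (H 0 i)) -> deg_le_pred H k.
Proof.
move=> Hk i; rewrite mmeasureE; apply/bigmax_leqP_seq => m.
by rewrite mcoeff_msupp => /Hk[].
Qed.

Lemma log_polyE (R : realType) (s d M N : nat) (eta : 'rV[R[i]]_d -> 'I_M -> R[i])
    (h : multinom d -> 'rV[mpoly M R[i]]_s) x : h (@mnm0 d) = 0 ->
  log_poly eta h N x =
  \row_j \sum_(n : bmultinom d N) meval (eta x) (h n 0 j) * mmap1 (x 0) n.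
Proof.
move=> h0; apply/rowP => j; rewrite summxE mxE big_mkcond; apply: eq_bigr => n _.
rewrite !mxE mulrC; case: posnP => // /eqP; rewrite mdeg_eq0 => /eqP ->.
by rewrite h0 mxE meval0 mul0r.
Qed.

Lemma log_poly_small (R : realType) (s d N : nat) (nu : 'I_d -> R)
    (v : 'rV[R[i]]_d -> 'I_d -> R[i]) (h : multinom d -> 'rV[mpoly d R[i]]_s) (eps : R) :
  (forall x l, modulus (v x l) = `|nu l * ln (modulus (x 0 l))|) ->
  log_normed h -> 0 < eps ->
  exists2 delta : R, 0 < delta & forall x, polydisc delta x -> forall i,
    \sum_(n : bmultinom d N) modulus (meval (v x) (h n 0 i) * mmap1 (x 0) n) <= eps.
Proof.
move=> v_modulus Hh eps0; apply/near_polydisc; apply: filter_forall => i.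
(* An equal share of eps for each term; the successor avoids a division by 0 when there are no
   terms. *)
pose b := eps / #|{: bmultinom d N}|.+1%:R.
have b0 : 0 < b by rewrite divr_gt0.
have small (n : bmultinom d N) : \forall x \near nbhs (0 : 'rV[(R[i] : numFieldType)]_d),
    modulus (meval (v x) (h n 0 i) * mmap1 ((x : 'rV[R[i]]_d) 0) n) <= b.
  have [n0|n0] := eqVneq (bmnm n) (@mnm0 d); last exact: (log_term_small v_modulus n0 (Hh n i)).
  apply: nearW => x; have -> : h n 0 i = 0; last by rewrite meval0 mul0r modulus0 ltW.
  by apply: (@log_bounded_eq0 _ _ n); have := Hh n i; rewrite n0 mdeg0.
near=> x; apply: (@le_trans _ _ (\sum_(n : bmultinom d N) b)).
  apply: ler_sum => n _; move: n; near: x; apply: filter_forall => n; apply: small.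
rewrite sumr_const -mulr_natr /b -mulrA ler_piMr ?(ltW eps0) //.
by rewrite ler_pdivrMl ?ltr0n // mulr1 ler_nat.
Unshelve. all: by end_near. Qed.

Unset Implicit Arguments.
Set Strict Implicit.
Set Printing Implicit Defensive.

(* Vectors are rows, so the matrix A = Df(0) (the library's
   jacobian) acts by v |-> v *m A, and the eigenvectors are the rows of e. *)
Theorem proposition4p9
    (R : realType) (s d : nat) (hds : (d <= s)%N)
    (f : 'rV[R[i]]_s -> 'rV[R[i]]_s)
    (f_analytic : analytic_at0 f) (f0 : f 0 = 0)
    (A : 'M[R[i]]_s) (A_Df0 : A = jacobian f 0) (A_unit : A \in unitmx)
    (e : 'M[R[i]]_s) (lam : 'I_s -> R[i])
    (e_basis : e \in unitmx)
    (e_eigen : forall j, row j e *m A = lam j *: row j e)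
    (lam1 : 'I_d -> R[i]) (lam1E : forall j, lam1 j = lam (widen_ord hds j))
    (lam1_lt1 : forall j, modulus (lam1 j) < 1)
    (gamma : R) (gamma01 : 0 < gamma < 1)
    (N : nat) :
  exists (M : nat) (p : 'M[R]_(M, d)),
    let eta := log_var (exponent gamma lam1) p in
    power_coefs p /\
    exists (h r : multinom d -> 'rV[mpoly M R[i]]_s)
           (RN : 'rV[R[i]]_d -> 'rV[R[i]]_s),
      let invariance (x : 'rV[R[i]]_d) :=
        f (log_poly eta h N x) = log_poly eta h N (diag_action lam1 x) + RN x /\
        sums_to (log_tail eta r N x) (RN x) in
      [/\ forall n, (1 <= mdeg n < N)%N -> support_condition p h n,
          forall l : 'I_d,
            h (mnm1 l) = map_mx (mpolyC M (R := R[i])) (row (widen_ord hds l) e),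
          forall n, (1 <= mdeg n < N)%N -> deg_le_pred (h n) (mdeg n),
          forall n, (N <= mdeg n)%N -> support_condition p r n &
          (exists2 delta : R, 0 < delta &
             forall x, polydisc delta x -> invariance x) /\
          (entire f -> forall x, invariance x)].
Proof.
pose C := (R[i] : numFieldType).
have lam_neq0 j : lam j != 0.
  apply/eqP => lam0; have := e_eigen j; rewrite lam0 scale0r => /(congr1 (mulmx^~ (invmx A))).
  rewrite mulmxK // mul0mx => /(congr1 (mulmx^~ (invmx e))).
  rewrite -row_mul mulmxV // mul0mx row1 => /rowP /(_ j) /eqP.
  by rewrite !mxE !eqxx oner_eq0.
have lam1_neq0 j : lam1 j != 0 by rewrite lam1E.
(* A single expansion, the everywhere convergent one if f is entire, so that the same [h] and [r]
   serve the local and the global claim. *)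
have [a [rho [rho0 fa fa_entire]]] : exists (a : multinom s -> 'rV[R[i]]_s) (rho : R),
    [/\ 0 < rho, forall z, polydisc rho z -> sums_to (power_series_term a z) (f z) &
        entire f -> forall z, sums_to (power_series_term a z) (f z)].
  have [[a fa]|f_not_entire] := pselect (entire f); first by exists a, 1; split.
  by have [a [rho rho0 fa]] := f_analytic; exists a, rho; split.
have a0 := power_series_coef0 rho0 f0 fa.
have e_eig j i : \sum_k e j k * a (mnm1 k) 0 i = lam j * e j i.
  have /rowP /(_ i) := e_eigen j; rewrite !mxE => <-; apply: eq_bigr => k _.
  by rewrite !mxE A_Df0 (jacobian_power_series rho0 f0 fa).
have ln_gamma_lt0 : ln gamma < 0 by rewrite ln_lt0.
have c_neq0 : (ln gamma)%:C != 0 :> C.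
  by rewrite -(rmorph0 (real_complex R)) (inj_eq (@complexI R)) lt_eqF.
have [h [Hh hl hE]] := formal_invariance (widen_ord hds) a0 e_basis e_eig lam_neq0 c_neq0 N.
have h0 : h (@mnm0 d) = 0.
  apply/rowP => i; rewrite mxE; apply: (@log_bounded_eq0 _ _ (@mnm0 d)).
  by have := Hh (@mnm0 d) i; rewrite mdeg0.
exists d, 1%:M; move=> eta; split; first exact: power_coefs1.
have eta_modulus x l : modulus (eta x l) = `|exponent gamma lam1 l * ln (modulus (x 0 l))|.
  by rewrite /eta log_var1E modulus_real.
(* With the remainder defined as a difference, the equation is immediate; what has to be proved is
   that the tail sums to it. *)
exists h, (comp_coef a h N),
  (fun x => f (log_poly eta h N x) - log_poly eta h N (diag_action lam1 x)); move=> invariance.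
have invarianceP x (zhat : 'I_s -> R) :
    (forall i, \sum_(n : bmultinom d N) modulus (meval (eta x) (h n 0 i) * mmap1 (x 0) n)
       <= zhat i) ->
    (forall z : 'rV[R[i]]_s, (forall i, modulus (z 0 i) <= zhat i) ->
       sums_to (power_series_term a z) (f z)) ->
    invariance x.
  move=> h_small f_sum; split; first by rewrite addrC subrK.
  apply/sums_toP => i; have := csum_to_substitution Hh h_small f_sum i.
  rewrite -log_polyE // => /(csum_to_remove (bounded_mnms d N)).
  rewrite !mxE sum_bounded_mnms; set l := _ - _; set l' := _ - _.
  (* The removed terms, of degree below N, sum to h(Ax) by the formal invariance equation. *)
  have -> : l = l'.
    congr (_ - _); rewrite log_polyE // mxE; apply: eq_bigr => n _.
    rewrite (@meval_diag_action _ _ gamma _ lam1_neq0 lam1_lt1 _ _ _ x (Hh n i)) hE ?bmdeg // mevalZ.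
    have -> : mmap1 lam1 n = mmap1 (lam \o widen_ord hds) n by apply: mmap1_eq => j; apply: lam1E.
    by rewrite mulrCA mulrA.
  move=> F_sum eps /F_sum[S HS]; exists S => S' /HS; congr (modulus (_ - _) < _).
  apply: eq_bigr => n _; rewrite mem_bounded_mnms /log_tail; case: ltnP => _.
    by rewrite [in RHS]mxE.
  by rewrite [in RHS]mxE [in RHS]mxE.
split.
- by move=> n _; apply: (support_condition1 (k := mdeg n)) => i; apply: Hh.
- exact: hl.
- by move=> n _; apply: (deg_le_pred_log_bounded (n := n)) => i; apply: Hh.
- move=> n _; apply: (support_condition1 (k := (mdeg n).+1)) => i.
  exact: log_bounded_comp_coef.
split=> [|f_entire x]; last first.
  (* For entire f the majorants themselves can serve as radii, whatever their size. *)
  apply: (invarianceP x (fun i => \sum_(n : bmultinom d N)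
    modulus (meval (eta x) (h n 0 i) * mmap1 (x 0) n))) => // z _.
  exact: fa_entire.
(* The closed polydisc of radius rho / 2 lies inside the open polydisc of convergence. *)
have rho2 : 0 < rho / 2%:R by rewrite divr_gt0.
have [delta delta0 Hd] := log_poly_small N eta_modulus Hh rho2.
exists delta => // x /Hd h_small; apply: (invarianceP x (fun=> rho / 2%:R) h_small) => z z_le.
apply: fa => i; apply: le_lt_trans (z_le i) _.
by rewrite ltr_pdivrMr // mulr_natr mulr2n ltrDl.
Qed.
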